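(* Let $\tau$ be a structure. If $\tau$ is Polish with preserved roots, then the associated local GH-type topology with preserved roots on $\mathfrak{M}_\bullet(\tau)$ is Polish.
   Context: A bcm (boundedly-compact metric) space is a non-empty metric space in which every closed ball of finite radius is compact; a rooted bcm space $(X,\rho_X)$ is a bcm space $X$ with a distinguished point $\rho_X$. The metric of $X$ is denoted $d_X$, and $D_X(x,r)=\{y: d_X(x,y)\le r\}$. An isometric embedding is a distance-preserving map (not necessarily onto); an isometry is a bijective one; a map is root-preserving if it sends root to root. A topological embedding is a homeomorphism onto its image. Structure: a functor $\tau$ from the category of bcm spaces (morphisms: isometric embeddings) to the category of metrizable topological spaces (morphisms: topological embeddings). That is, to each bcm space $X$ it assigns a metrizable space $\tau(X)$ and to each isometric embedding $f\colon X\to Y$ a topological embedding $\tau_f\colon\tau(X)\to\tau(Y)$, with $\tau_{\mathrm{id}_X}=\mathrm{id}_{\tau(X)}$ and $\tau_{g\circ f}=\tau_g\circ\tau_f$. When $X$ is isometrically embedded into $Y$ by $f$, $\tau(X)$ is regarded as a subspace of $\tau(Y)$ via $\tau_f$. $\tau$ is continuous if all of the following hold. Embedding-continuity: if $f_n\colon X\to Y$, $n\in\mathbb{N}\cup\{\infty\}$, are isometric embeddings between bcm spaces with $f_n\to f_\infty$ uniformly on compact sets, then $\tau_{f_n}(a)\to\tau_{f_\infty}(a)$ for all $a\in\tau(X)$. Upper and lower semicontinuity: whenever bcm spaces $X_n$, $n\in\mathbb{N}\cup\{\infty\}$, are isometrically embedded into a common bcm space $Y$ so that $X_n\to X_\infty$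 in the Fell topology as subsets of $Y$, (upper) if $a_n\in\tau(X_n)$ converge to some $a\in\tau(Y)$ then $a\in\tau(X_\infty)$; (lower) for every $a\in\tau(X_\infty)$ there are a subsequence $(n_k)$ and $a_k\in\tau(X_{n_k})$ with $a_k\to a$ in $\tau(Y)$. The Fell topology on closed subsets of $Y$ is generated by the sets $\{A: A\cap K=\emptyset\}$ ($K$ compact) and $\{A: A\cap U\ne\emptyset\}$ ($U$ open). Space-rooted metrization $\tau^{\mathrm{srm}}$ of $\tau$: a choice, for each rooted bcm space $(X,\rho_X)$, of a metric $d^{\tau^{\mathrm{srm}}}_{X,\rho_X}$ on $\tau(X)$ inducing the given topology, such that for every root-preserving isometric embedding $f\colon(X,\rho_X)\to(Y,\rho_Y)$ the map $\tau_f$ is distance-preserving. It is complete if all these metrics are complete. $\tau$ is Polish with preserved roots if there exist another structure $\tilde\tau$, a topological embedding $\eta\colon\tau\Rightarrow\tilde\tau$ (a family of topological embeddings $\eta_X\colon\tau(X)\to\tilde\tau(X)$ with $\eta_Y\circ\tau_f=\tilde\tau_f\circ\eta_X$ for every isometric embedding $f\colon X\to Y$), and a sequence $(\tilde\tau_k)_{k\ge1}$, where each $\tilde\tau_k$ assigns to every rooted bcm space $(X,\rho_X)$ a subset $\tilde\tau_k(X,\rho_X)\subseteq\tilde\tau(X)$ with $\tilde\tau_f(\tilde\tau_k(X,\rho_X))\subseteq\tilde\tau_k(Y,\rho_Y)$ for every root-preserving isometric embedding $f\colon(X,\rho_X)\to(Y,\rho_Y)$, such that: (P1) $\tilde\tau$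 is continuous and admits a complete space-rooted metrization; (P2) each $\tilde\tau_k(X,\rho_X)$ is open in $\tilde\tau(X)$, and $\tilde\tau_k$ is pullback-stable: $\tilde\tau_f^{-1}(\tilde\tau_k(Y,\rho_Y))=\tilde\tau_k(X,\rho_X)$ for every root-preserving isometric embedding $f\colon(X,\rho_X)\to(Y,\rho_Y)$; (P3) $\eta_X(\tau(X))=\bigcap_{k\ge1}\tilde\tau_k(X,\rho_X)$ for every rooted bcm space $(X,\rho_X)$. Such a $\tau$ is automatically embedding-continuous and admits a space-rooted metrization. $\mathfrak{M}_\bullet(\tau)$: the set of (representatives of) equivalence classes of triples $(X,\rho_X,a_X)$, with $(X,\rho_X)$ a rooted bcm space and $a_X\in\tau(X)$, where $(X,\rho_X,a_X)\sim(Y,\rho_Y,a_Y)$ iff there is a root-preserving isometry $f\colon X\to Y$ with $\tau_f(a_X)=a_Y$. Hausdorff metric on compact subsets (including $\emptyset$) of a metric space $M$: $d^H_M(A,B)=\inf\{\varepsilon\ge0: A\subseteq B^\varepsilon, B\subseteq A^\varepsilon\}$, where $A^\varepsilon=\{x:\exists y\in A, d_M(x,y)\le\varepsilon\}$ and $\inf\emptyset=\infty$. For a rooted bcm space $(M,\rho)$ and closed $A,B\subseteq M$, $$d^F_{M,\rho}(A,B)=\int_0^\infty e^{-r}\bigl(1\wedge d^H_M(A\cap D_M(\rho,r),B\cap D_M(\rho,r))\bigr)dr.$$ The local GH-type topology with preserved roots on $\mathfrak{M}_\bullet(\tau)$ is the topology induced by the metric $$d_{\mathfrak{M}_\bullet}^{\tau^{\mathrm{srm}}}(\mathcal{X},\mathcal{Y})=\inf_{f,g,Z}\bigl\{d^F_{Z,\rho_Z}(f(X),g(Y))\vee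 d^{\tau^{\mathrm{srm}}}_{Z,\rho_Z}(\tau_f(a_X),\tau_g(a_Y))\bigr\},$$ $\mathcal{X}=(X,\rho_X,a_X)$, $\mathcal{Y}=(Y,\rho_Y,a_Y)$, the infimum being over all rooted bcm spaces $(Z,\rho_Z)$ and root-preserving isometric embeddings $f\colon X\to Z$, $g\colon Y\to Z$; it does not depend on the choice of the space-rooted metrization $\tau^{\mathrm{srm}}$.
   Formalization: The formal theorem additionally assumes that every $\tilde\tau(X)$ is separable; without this the claim fails, e.g. for the constant structure $\tau(X)=S$ with $S$ an uncountable discrete space. *)

(* Defs.v *)
From HB Require Import structures.
From mathcomp Require Import all_boot all_order all_algebra.
From mathcomp Require Import all_classical all_reals all_analysis.

Set Implicit Arguments.
Unset Strict Implicit.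
Unset Printing Implicit Defensive.

Import Order.TTheory GRing.Theory Num.Theory.
Import numFieldNormedType.Exports.

Local Open Scope classical_set_scope.
Local Open Scope ring_scope.

Section metrization.
Context {R : realType}.

Definition is_metric (T : Type) (d : T -> T -> R) : Prop :=
  [/\ forall x, d x x = 0,
      forall x y, d x y = 0 -> x = y,
      forall x y, d x y = d y x &
      forall y x z, d x z <= d x y + d y z].

Definition induces_topology (T : topologicalType) (d : T -> T -> R) : Prop :=
  forall U : set T, open U <->
    forall x, U x -> exists2 e, 0 < e & [set y | d x y < e] `<=` U.

Definition metrizes (T : topologicalType) (d : T -> T -> R) : Prop :=
  is_metric d /\ induces_topology d.

Definition complete_dist (T : Type) (d : T -> T -> R) : Prop :=
  forall u : nat -> T,
    (forall e, 0 < e -> exists N, forall m n,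
       (N <= m)%N -> (N <= n)%N -> d (u m) (u n) < e) ->
    exists l, d (u n) l @[n --> \oo] --> (0 : R).

End metrization.

Definition metrizable (R : realType) (T : topologicalType) : Prop :=
  exists d : T -> T -> R, metrizes d.

Definition separable (T : topologicalType) : Prop :=
  exists2 D : set T, countable D & dense D.

(* The empty space counts as Polish. *)
Definition polish (R : realType) (T : topologicalType) : Prop :=
  separable T /\ exists d : T -> T -> R, metrizes d /\ complete_dist d.

(* A homeomorphism onto its image: the last clause says that f is open as a map
   onto range f with the subspace topology. *)
Definition topological_embedding (T U : topologicalType) (f : T -> U) : Prop :=
  [/\ injective f, continuous f &
      forall A : set T, open A ->
        exists2 B : set U, open B & f @` A = B `&` range f].

(* The carrier is a bare type rather than a metricType, so that the triples
   defined below form a type small enough to carry a topology. This loses nothing: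
   a bcm space is complete and separable, hence isometric to one carried by a type
   in Set. *)
Record mspace (R : realType) := MSpace {
  ms_carrier :> Type;
  ms_dist : ms_carrier -> ms_carrier -> R;
  ms_metric : is_metric ms_dist }.

Section mspace_metricType.
Context {R : realType} (X : mspace R).

HB.instance Definition _ := gen_eqMixin (ms_carrier X).
HB.instance Definition _ := gen_choiceMixin (ms_carrier X).

Let ms_distxx (x : X) : ms_dist x x = 0.
Proof. by have [] := ms_metric X. Qed.

Let ms_dist_positivity (x y : X) : ms_dist x y = 0 -> x = y.
Proof. by have [_ + _ _] := ms_metric X; apply. Qed.

Let ms_dist_sym (x y : X) : ms_dist x y = ms_dist y x.
Proof. by have [_ _ + _] := ms_metric X; apply. Qed.

Let ms_dist_triangle (y x z : X) : ms_dist x z <= ms_dist x y + ms_dist y z.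
Proof. by have [_ _ _] := ms_metric X; apply. Qed.

HB.instance Definition _ := isMetric.Build R (ms_carrier X)
  ms_distxx ms_dist_positivity ms_dist_sym ms_dist_triangle.

End mspace_metricType.

Definition cball (R : realType) (X : metricType R) (x : X) (r : R) : set X :=
  [set y | mdist x y <= r].

Record bcm (R : realType) := Bcm {
  bcm_mspace :> mspace R;
  bcm_nonempty : inhabited bcm_mspace;
  bcm_compact : forall (x : bcm_mspace) (r : R), compact (cball x r) }.

Record rbcm (R : realType) := Rbcm {
  rbcm_sort :> bcm R;
  root : rbcm_sort }.
Arguments root {R} r.

Record isoemb (R : realType) (X Y : bcm R) := IsoEmb {
  isoemb_fun :> X -> Y;
  isoemb_mdist : forall x x', mdist (isoemb_fun x) (isoemb_fun x') = mdist x x' }.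

Record risoemb (R : realType) (X Y : rbcm R) := RIsoEmb {
  risoemb_emb :> isoemb X Y;
  risoemb_root : risoemb_emb (root X) = root Y }.

Section isoemb_category.
Context {R : realType}.

Definition isoemb_id (X : bcm R) : isoemb X X :=
  @IsoEmb R X X id (fun _ _ => erefl).

Definition isoemb_comp (X Y Z : bcm R) (g : isoemb Y Z) (f : isoemb X Y) :
    isoemb X Z :=
  @IsoEmb R X Z (g \o f)
    (fun x x' => etrans (isoemb_mdist g (f x) (f x')) (isoemb_mdist f x x')).

Lemma isoemb_ext (X Y : bcm R) (f g : isoemb X Y) : f =1 g -> f = g.
Proof.
case: f g => [f fi] [g gi] /= /funext fg; subst g.
by congr IsoEmb; exact: Prop_irrelevance.
Qed.

Lemma isoemb_inj (X Y : bcm R) (f : isoemb X Y) : injective f.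
Proof.
move=> x x' ff; apply: mdist_positivity.
by rewrite -(isoemb_mdist f) ff mdistxx.
Qed.

Lemma isoemb_continuous (X Y : bcm R) (f : isoemb X Y) : continuous f.
Proof.
move=> x A /nbhs_ballP[e /= e0 eA]; apply/nbhs_ballP; exists e => //= y.
by rewrite ballEmdist /= => xy; apply: eA; rewrite ballEmdist /= isoemb_mdist.
Qed.

Lemma closed_range_isoemb (X Y : bcm R) (f : isoemb X Y) : closed (range f).
Proof.
move=> y cy; have [x0] := bcm_nonempty X.
pose r := mdist (f x0) y + 1.
have cK : closed (f @` cball x0 r).
  apply: compact_closed; first exact: metric_hausdorff.
  apply: continuous_compact; last exact: bcm_compact.
  by apply: continuous_subspaceT; exact: isoemb_continuous.
suff: (f @` cball x0 r) y by case=> x _ <-; exists x.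
apply: cK => B By.
have By1 : nbhs y (B `&` ball y 1) by apply: filterI => //; exact: nbhsx_ballx.
have [_ [[x _ <-] [Bfx yfx]]] := cy _ By1.
exists (f x); split=> //; exists x => //.
rewrite /cball /= -(isoemb_mdist f) /r.
rewrite (le_trans (metric_triangle _ y _))// lerD2l ltW//.
Qed.

Lemma isoemb_inverse (X Y : rbcm R) (f : risoemb X Y) :
  set_bij setT setT f -> exists g : risoemb Y X, cancel f g /\ cancel g f.
Proof.
move=> [_ _ fs]; have h y : exists x, f x = y.
  by have [x _ <-] := fs y I; exists x.
pose g y := projT1 (cid (h y)).
have gK : cancel g f by move=> y; rewrite /g; case: cid.
have fK : cancel f g by move=> x; apply: (@isoemb_inj _ _ f); rewrite gK.
have gi x x' : mdist (g x) (g x') = mdist x x' by rewrite -(isoemb_mdist f) !gK.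
have gr : g (root Y) = root X by rewrite -(risoemb_root f) fK.
by exists (@RIsoEmb R Y X (IsoEmb gi) gr).
Qed.

End isoemb_category.

Definition fell (R : realType) (Y : bcm R) : Type := {A : set Y | closed A}.

Section fell_topology.
Context {R : realType} (Y : bcm R).

Definition fell_subbase : set (set (fell Y)) :=
  [set [set A : fell Y | sval A `&` K = set0] | K in [set K : set Y | compact K]]
  `|`
  [set [set A : fell Y | sval A `&` U !=set0] | U in [set U : set Y | open U]].

HB.instance Definition _ := gen_eqMixin (fell Y).
HB.instance Definition _ := gen_choiceMixin (fell Y).
HB.instance Definition _ := isSubBaseTopological.Build (fell Y) fell_subbase id.

End fell_topology.

Definition fell_range (R : realType) (X Y : bcm R) (f : isoemb X Y) : fell Y :=
  exist _ (range f) (@closed_range_isoemb R X Y f).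

Record structure (R : realType) := Structure {
  str_obj :> bcm R -> topologicalType;
  str_map : forall X Y : bcm R, isoemb X Y -> str_obj X -> str_obj Y;
  str_metrizable : forall X, metrizable R (str_obj X);
  str_embedding : forall (X Y : bcm R) (f : isoemb X Y),
    topological_embedding (str_map f);
  str_id : forall X (a : str_obj X), str_map (isoemb_id X) a = a;
  str_comp : forall (X Y Z : bcm R) (g : isoemb Y Z) (f : isoemb X Y) a,
    str_map (isoemb_comp g f) a = str_map g (str_map f a) }.

Section structures.
Context {R : realType}.
Implicit Type tau : structure R.

Definition embedding_continuous tau : Prop :=
  forall (X Y : bcm R) (f : nat -> isoemb X Y) (foo : isoemb X Y),
    {family compact, (fun n => f n : X -> Y) @ \oo --> (foo : X -> Y)} ->
    forall a : tau X, str_map (f n) a @[n --> \oo] --> str_map foo a.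

Definition upper_semicontinuous tau : Prop :=
  forall (X : nat -> bcm R) (Xoo Y : bcm R)
         (f : forall n, isoemb (X n) Y) (foo : isoemb Xoo Y),
    fell_range (f n) @[n --> \oo] --> fell_range foo ->
    forall (a : forall n, tau (X n)) (b : tau Y),
      str_map (f n) (a n) @[n --> \oo] --> b ->
      range (str_map (s := tau) foo) b.

Definition lower_semicontinuous tau : Prop :=
  forall (X : nat -> bcm R) (Xoo Y : bcm R)
         (f : forall n, isoemb (X n) Y) (foo : isoemb Xoo Y),
    fell_range (f n) @[n --> \oo] --> fell_range foo ->
    forall a : tau Xoo,
      exists (n_ : nat -> nat) (b : forall k, tau (X (n_ k))),
        {homo n_ : i j / (i < j)%N} /\
        str_map (f (n_ k)) (b k) @[k --> \oo] --> str_map foo a.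

Definition str_continuous tau : Prop :=
  [/\ embedding_continuous tau, upper_semicontinuous tau &
      lower_semicontinuous tau].

End structures.

Record srm (R : realType) (tau : structure R) := Srm {
  srm_dist : forall X : rbcm R, tau X -> tau X -> R;
  srm_metrizes : forall X : rbcm R, metrizes (@srm_dist X);
  srm_isometric : forall (X Y : rbcm R) (f : risoemb X Y) (a b : tau X),
    srm_dist (str_map f a) (str_map f b) = srm_dist a b }.
Arguments srm_dist {R tau} s X a b.

Definition complete_srm (R : realType) (tau : structure R) (S : srm tau) : Prop :=
  forall X : rbcm R, complete_dist (srm_dist S X).

Section polish_structures.
Context {R : realType}.

Definition str_topological_embedding (tau tau' : structure R)
    (eta : forall X : bcm R, tau X -> tau' X) : Prop :=
  (forall X, topological_embedding (eta X)) /\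
  (forall (X Y : bcm R) (f : isoemb X Y) (a : tau X),
     eta Y (str_map f a) = str_map f (eta X a)).

Definition rooted_substructure (tau : structure R)
    (sub : forall X : rbcm R, set (tau X)) : Prop :=
  forall (X Y : rbcm R) (f : risoemb X Y), str_map f @` sub X `<=` sub Y.

Definition pullback_stable (tau : structure R)
    (sub : forall X : rbcm R, set (tau X)) : Prop :=
  forall (X Y : rbcm R) (f : risoemb X Y), str_map f @^-1` sub Y = sub X.

(* tau is Polish with preserved roots, by way of the structure tau'.

   This alone does not make GHspace below separable. If S is an uncountable
   discrete space, the constant structure tau X = S with identity maps is
   continuous, has the discrete metric as a complete space-rooted metrization and
   satisfies the definition with tau' = tau, but classes of triples with distinct
   marks in S are at distance at least 1. Separability of the spaces tau' X has to
   be assumed besides. *)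
Definition polish_with_preserved_roots (tau tau' : structure R) : Prop :=
  exists (eta : forall X : bcm R, tau X -> tau' X)
         (sub : nat -> forall X : rbcm R, set (tau' X)),
  [/\ str_topological_embedding eta /\ (forall k, rooted_substructure (sub k)),
      str_continuous tau' /\ (exists S : srm tau', complete_srm S),
      forall k, (forall X : rbcm R, open (sub k X)) /\ pullback_stable (sub k) &
      forall X : rbcm R, range (eta X) = \bigcap_k sub k X].

End polish_structures.

Section hausdorff_fell_distances.
Context {R : realType}.

Definition thickening (M : metricType R) (A : set M) (e : R) : set M :=
  [set x | exists2 y, A y & mdist x y <= e].

Definition hausdorff_dist (M : metricType R) (A B : set M) : \bar R :=
  ereal_inf (EFin @` [set e : R |
    [/\ 0 <= e, A `<=` thickening B e & B `<=` thickening A e]]).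

Definition fell_dist (M : rbcm R) (A B : set M) : \bar R :=
  (\int[lebesgue_measure]_(r in `[0%R, +oo[%classic)
     ((expR (- r))%:E *
      mine 1 (hausdorff_dist (A `&` cball (root M) r) (B `&` cball (root M) r))))%E.

End hausdorff_fell_distances.

Record marked (R : realType) (tau : structure R) := Marked {
  mk_space : rbcm R;
  mk_mark : tau mk_space }.

Section marked_quotient.
Context {R : realType} (tau : structure R).

HB.instance Definition _ := gen_eqMixin (marked tau).
HB.instance Definition _ := gen_choiceMixin (marked tau).

Definition marked_iso (x y : marked tau) : Prop :=
  exists f : risoemb (mk_space x) (mk_space y),
    set_bij setT setT f /\ str_map f (mk_mark x) = mk_mark y.

Definition marked_equiv (x y : marked tau) : bool := `[< marked_iso x y >].

Lemma marked_equiv_refl : reflexive marked_equiv.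
Proof.
move=> x; apply/asboolP.
exists (@RIsoEmb R _ _ (isoemb_id (mk_space x)) erefl); split; last exact: str_id.
by split=> // y _; exists y.
Qed.

Lemma marked_equiv_sym : symmetric marked_equiv.
Proof.
suff h x y : marked_equiv x y -> marked_equiv y x.
  by move=> x y; apply/idP/idP; exact: h.
move=> /asboolP[f [fb fa]]; apply/asboolP.
have [g [fK gK]] := isoemb_inverse fb; exists g; split.
  split=> //; first by move=> u v _ _; exact: (can_inj gK).
  by move=> u _; exists (f u).
rewrite -fa -str_comp (_ : isoemb_comp g f = isoemb_id _) ?str_id//.
exact: isoemb_ext.
Qed.

Lemma marked_equiv_trans : transitive marked_equiv.
Proof.
move=> y x z /asboolP[f [[_ _ fs] fa]] /asboolP[g [[_ _ gs] ga]]; apply/asboolP.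
have hr : isoemb_comp g f (root (mk_space x)) = root (mk_space z).
  by rewrite /= !risoemb_root.
exists (RIsoEmb hr); split; last by rewrite /= str_comp fa.
split=> //; first by move=> u v _ _; exact: isoemb_inj.
move=> u _; have [v _ <-] := gs u I; have [w _ <-] := fs v I.
by exists w.
Qed.

Canonical marked_equivRel :=
  EquivRel marked_equiv marked_equiv_refl marked_equiv_sym marked_equiv_trans.
Canonical marked_encModRel := defaultEncModRel marked_equiv.

Definition marked_class : Type := {eq_quot marked_equiv}%qT.

HB.instance Definition _ := EqQuotient.on marked_class.
HB.instance Definition _ := Choice.on marked_class.

End marked_quotient.

Section GH_distance.
Context {R : realType} {tau : structure R} (S : srm tau).

Definition marked_dist (x y : marked tau) : \bar R :=
  ereal_inf [set r | exists (Z : rbcm R)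
      (f : risoemb (mk_space x) Z) (g : risoemb (mk_space y) Z),
    r = maxe (fell_dist (range f) (range g))
             (srm_dist S Z (str_map f (mk_mark x)) (str_map g (mk_mark y)))%:E].

Definition class_dist (x y : marked_class tau) : \bar R :=
  marked_dist (repr x) (repr y).

End GH_distance.

(* The alias carries S, on which the topology declared below depends. *)
Definition GHspace (R : realType) (tau : structure R) (S : srm tau) : Type :=
  marked_class tau.

Section GH_topology.
Context {R : realType} {tau : structure R} (S : srm tau).
Local Notation GHspace := (GHspace S).

HB.instance Definition _ := Choice.on GHspace.

Definition GHopen : set (set GHspace) := [set U |
  forall x, U x -> exists2 e : R, 0 < e & [set y | (class_dist S x y < e%:E)%E] `<=` U].

Lemma GHopenT : GHopen setT.
Proof. by move=> x _; exists 1. Qed.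

Lemma GHopenI : setI_closed GHopen.
Proof.
move=> A B oA oB x [/oA[e e0 eA] /oB[e' e'0 eB]].
exists (Num.min e e'); first by rewrite lt_min e0.
move=> y /= xy; split; [apply: eA|apply: eB]; apply: (lt_le_trans xy) => /=.
  by rewrite lee_fin ge_min lexx.
by rewrite lee_fin ge_min lexx orbT.
Qed.

Lemma GHopen_bigU (I : Type) (f : I -> set GHspace) :
  (forall i, GHopen (f i)) -> GHopen (\bigcup_i f i).
Proof.
move=> fo x [i _ /fo[e e0 ef]]; exists e => // y /ef fy; by exists i.
Qed.

HB.instance Definition _ :=
  isOpenTopological.Build GHspace GHopenT GHopenI GHopen_bigU.

End GH_topology.

(* Main.v *)
Require Import Defs.
From mathcomp Require Import all_boot all_order all_algebra.
From mathcomp Require Import all_classical all_reals all_analysis.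
From mathcomp Require Import measurable_realfun ring lra.

(* Two marked spaces are compared by linking them: embedding both in a common
   space Z where their images are close on large balls and their marks are close.
   For the complete metrization S' of tau' the resulting pseudometric mmdist S' on
   triples is complete: the links of a fast Cauchy sequence are glued along a chain
   into a single bcm space W, the limit is the set of limits of points of the X_n in
   W, and it carries the limit of the marks by upper semicontinuity. It vanishes
   exactly on isomorphic triples (Arzela-Ascoli and embedding-continuity), and
   finite spaces with distances in (1/N)Z carrying marks in countable dense sets are
   dense in it, by lower semicontinuity. Gluing a sequence of links with a fixed
   centre X into one bcm space shows that the topology does not depend on the
   metrization of the structure and that each tau'_k is open in it. Hence, by (P3),
   the triples of tau form a G_delta among those of tau', and the classical
   remetrization of G_delta subsets of complete spaces applies. *)

Set Implicit Arguments.
Unset Strict Implicit.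
Unset Printing Implicit Defensive.

Import Order.TTheory GRing.Theory Num.Theory.
Import numFieldNormedType.Exports.
Import Defs.

Local Open Scope classical_set_scope.
Local Open Scope ring_scope.

(** * Gluing pseudometrics along trees *)

Section pseudometrics.
Context {R : realType}.

(** Every pair of triples has its own infimum over spaces [Z], while the axioms on [tau'] speak of
    what happens inside one space. Hence the recurrent pattern of gluing a sequence of links and
    arguing with convergent marks there. Two facts make it work. The glued space is boundedly
    compact because the links become tight: each bounded part is, up to any error, covered by
    finitely many pieces. And moving from [Z] to the glued space loses nothing, since [fclose] and
    the distance of the marks depend only on the cross distances [mdist (f x) (g y)], by [fcloseP]
    and [srm_coupling]. In [fclose] one number is both tolerance and inverse radius, which makes
    links composable; the price is that the integrated distance is bounded by [mmdist] only near a
    fixed centre. That suffices, as only topologies are compared. *)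

Definition pseudo_on (T : Type) (A : set T) (p : T -> T -> R) : Prop :=
  [/\ forall x, A x -> p x x = 0,
      forall x y, A x -> A y -> p x y = p y x &
      forall y x z, A x -> A y -> A z -> p x z <= p x y + p y z].

Lemma pseudo_on_ge0 (T : Type) (A : set T) p x y :
  pseudo_on A p -> A x -> A y -> 0 <= p x y.
Proof.
move=> [p0 ps pt] Ax Ay; have := pt y x x Ax Ay Ax.
by rewrite p0// (ps y x)//; lra.
Qed.

Lemma sub_pseudo_on (T : Type) (A B : set T) p :
  A `<=` B -> pseudo_on B p -> pseudo_on A p.
Proof.
by move=> AB [p0 ps pt]; split=> [x /AB /p0|x y /AB ? /AB ?|y x z /AB ? /AB ? /AB ?] //;
  [exact: ps|exact: pt].
Qed.

Lemma eq_pseudo_on (T : Type) (A : set T) p q :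
  (forall x y, A x -> A y -> q x y = p x y) -> pseudo_on A p -> pseudo_on A q.
Proof.
move=> qp [p0 ps pt]; split=> [x Ax|x y Ax Ay|y x z Ax Ay Az]; rewrite !qp//.
- exact: p0.
- exact: ps.
- exact: pt.
Qed.

Section glue_step.
Context {T : Type} (A B C : set T) (p e : T -> T -> R).
Hypotheses (AB : A `<=` B) (A0 : A !=set0) (BC : forall t, B t -> C t -> False).
Hypotheses (pB : pseudo_on B p) (eAC : pseudo_on (A `|` C) e).
Hypothesis pe : forall s t, A s -> A t -> p s t = e s t.

(** Amalgamation: a path from the old part [B] to the new part [C] has to cross [A], where [p] and
    [e] agree. *)
Definition glue_via (s t : T) : R := inf [set p s z + e z t | z in A].

Definition glue_dist (s t : T) : R :=
  if `[< B s >] then if `[< B t >] then p s t else glue_via s t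
  else if `[< B t >] then glue_via t s else e s t.

Let via_lb s t : B s -> C t -> has_lbound [set p s z + e z t | z in A].
Proof.
move=> Bs Ct; exists 0 => _ [z Az <-]; apply: addr_ge0.
  by apply: (pseudo_on_ge0 pB) => //; exact: AB.
by apply: (pseudo_on_ge0 eAC); [left|right].
Qed.

Let via_le s t z : B s -> C t -> A z -> glue_via s t <= p s z + e z t.
Proof.
by move=> Bs Ct Az; apply: ge_inf; [exact: via_lb|exists z].
Qed.

Let via_ge s t m : (forall z, A z -> m <= p s z + e z t) -> m <= glue_via s t.
Proof.
move=> h; apply: lb_le_inf.
  by have [z Az] := A0; exists (p s z + e z t), z.
by move=> _ [z Az <-]; exact: h.
Qed.

Let via_add s t s' t' m : B s -> C t ->
  (forall z z', A z -> A z' -> m <= (p s z + e z t) + (p s' z' + e z' t')) ->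
  m <= glue_via s t + glue_via s' t'.
Proof.
move=> Bs Ct h; rewrite -lerBlDr; apply: via_ge => z Az.
rewrite lerBlDr -lerBlDl; apply: via_ge => z' Az'.
by rewrite lerBlDl; exact: h.
Qed.

Lemma glue_distB s t : B s -> B t -> glue_dist s t = p s t.
Proof. by move=> Bs Bt; rewrite /glue_dist !asboolT. Qed.

Let glueC s t : C s -> C t -> glue_dist s t = e s t.
Proof. by move=> Cs Ct; rewrite /glue_dist !asboolF// => /BC; exact. Qed.

Let glueBC s t : B s -> C t -> glue_dist s t = glue_via s t.
Proof.
by move=> Bs Ct; rewrite /glue_dist (asboolT Bs) asboolF// => /BC; exact.
Qed.

Let glueCB s t : C s -> B t -> glue_dist s t = glue_via t s.
Proof.
by move=> Cs Bt; rewrite /glue_dist (asboolT Bt) asboolF// => /BC; exact.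
Qed.

Lemma glue_distAC s t : A s -> C t -> glue_dist s t = e s t.
Proof.
move=> As Ct; have Bs := AB As; rewrite glueBC//; have [e0 es et] := eAC.
apply/eqP; rewrite eq_le; apply/andP; split.
  apply: (le_trans (via_le Bs Ct As)).
  by case: pB => -> // _ _; rewrite add0r.
by apply: via_ge => z Az; rewrite pe//; apply: et; [left|left|right].
Qed.

Lemma glue_distA s t : (A `|` C) s -> (A `|` C) t -> glue_dist s t = e s t.
Proof.
have [e0 es et] := eAC.
case=> As [At|Ct].
- by rewrite glue_distB ?pe//; exact: AB.
- exact: glue_distAC.
- rewrite es; [|by right|by left].
  by rewrite -glue_distAC// glueCB ?glueBC//; exact: AB.
- by rewrite glueC.
Qed.

Local Ltac glue_simp := repeat match goal with
  | h : B ?x |- context [glue_dist ?x ?x] => rewrite (glue_distB h h)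
  | h : C ?x |- context [glue_dist ?x ?x] => rewrite (glueC h h)
  | h : B ?x, k : B ?y |- context [glue_dist ?x ?y] => rewrite (glue_distB h k)
  | h : B ?x, k : C ?y |- context [glue_dist ?x ?y] => rewrite (glueBC h k)
  | h : C ?x, k : B ?y |- context [glue_dist ?x ?y] => rewrite (glueCB h k)
  | h : C ?x, k : C ?y |- context [glue_dist ?x ?y] => rewrite (glueC h k)
  end.

Lemma pseudo_glue : pseudo_on (B `|` C) glue_dist.
Proof.
have [p0 ps pt] := pB; have [e0 es et] := eAC.
have inA z : A z -> (A `|` C) z by left.
have inC z : C z -> (A `|` C) z by right.
split.
- by move=> x [Bx|Cx]; glue_simp; [exact: p0|apply: e0; right].
- move=> x y [Bx|Cx] [By|Cy]; glue_simp => //.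
  + exact: ps.
  + by apply: es; right.
- move=> y x z [Bx|Cx] [By|Cy] [Bz|Cz]; glue_simp.
  + exact: pt.
  + rewrite -lerBlDl; apply: via_ge => a Aa; rewrite lerBlDl addrA.
    apply: (le_trans (via_le Bx Cz Aa)); rewrite lerD2r.
    by apply: pt => //; exact: AB.
  (* [x] and [z] are old, [y] is new: the excursion from [a] to [b] through [y] costs at least
     [e a b = p a b]. The case with [B] and [C] exchanged is symmetric. *)
  + apply: via_add => // a b Aa Ab.
    have := pt a x z Bx (AB Aa) Bz; have := pt b a z (AB Aa) (AB Ab) Bz.
    have := et y a b (inA _ Aa) (inC _ Cy) (inA _ Ab).
    rewrite -pe// (es b y (inA _ Ab) (inC _ Cy)) (ps b z (AB Ab) Bz); lra.
  + rewrite -lerBlDr; apply: via_ge => a Aa; rewrite lerBlDr -addrA.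
    apply: (le_trans (via_le Bx Cz Aa)); rewrite lerD2l.
    by apply: et; [left|right|right].
  + rewrite -lerBlDr; apply: via_ge => a Aa; rewrite lerBlDr.
    apply: (le_trans (via_le Bz Cx Aa)).
    by have := pt y z a Bz By (AB Aa); rewrite (ps z y)//; lra.
  + apply: via_add => // a b Aa Ab.
    have := et a x z (inC _ Cx) (inA _ Aa) (inC _ Cz).
    have := et b a z (inA _ Aa) (inA _ Ab) (inC _ Cz).
    have := pt y a b (AB Aa) By (AB Ab).
    rewrite pe// (es x a (inC _ Cx) (inA _ Aa)) (ps a y (AB Aa) By); lra.
  + rewrite -lerBlDl; apply: via_ge => a Aa; rewrite lerBlDl addrCA.
    apply: (le_trans (via_le Bz Cx Aa)); rewrite lerD2l.
    rewrite (es x y (inC _ Cx) (inC _ Cy)) addrC.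
    exact: (et y a x (inA _ Aa) (inC _ Cy) (inC _ Cx)).
  + by apply: et; right.
Qed.

End glue_step.
End pseudometrics.

Section tree_pseudometric.
Context {R : realType} {T : Type}.
Variables (tag : T -> nat) (par : nat -> nat) (e : T -> T -> R).

Let A i : set T := [set t | tag t = i].
Let B n : set T := [set t | (tag t <= n)%N].

Hypotheses (A0 : forall i, A i !=set0) (parE : forall j, (par j <= j)%N).
Hypothesis e0 : pseudo_on (A 0) e.
Hypothesis eS : forall j, pseudo_on (A (par j) `|` A j.+1) e.

(** Stage [m.+1] attaches piece [m.+1] along piece [par m]. A star has [par] constantly 0, a chain
    has [par] the identity. *)
Fixpoint tree_dist_rec n : T -> T -> R :=
  if n is m.+1 then glue_dist (A (par m)) (B m) (tree_dist_rec m) e else e.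

Definition tree_dist s t := tree_dist_rec (maxn (tag s) (tag t)) s t.

Let AB j : A (par j) `<=` B j.
Proof. by move=> t; rewrite /A /B /= => ->. Qed.

Let BA j t : B j t -> A j.+1 t -> False.
Proof. by rewrite /A /B /= => + tj; rewrite tj ltnn. Qed.

Let BSE j : B j.+1 = B j `|` A j.+1.
Proof.
apply/seteqP; split=> t; rewrite /A /B /=.
  by rewrite leq_eqVlt ltnS => /orP[/eqP|]; [right|left].
by case=> [|->//]; exact: leqW.
Qed.

(** The second clause is carried along because the next gluing step needs the distance built so far
    to agree with [e] on the piece of attachment. *)
Let tree_dist_recP n :
  pseudo_on (B n) (tree_dist_rec n) /\
  forall s t, B n s -> tag s = tag t -> tree_dist_rec n s t = e s t.
Proof.
elim: n => [|n [IH1 IH2]].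
  by split=> //; apply: sub_pseudo_on e0 => t; rewrite /A /B /= leqn0 => /eqP.
have pe s t : A (par n) s -> A (par n) t -> tree_dist_rec n s t = e s t.
  move=> As At; apply: IH2; first exact: AB.
  by rewrite As At.
split; first by rewrite BSE; exact: (pseudo_glue (@AB n) (A0 _) (@BA n) IH1 (eS n) pe).
move=> s t; rewrite BSE => -[Bs|As] st /=.
  by rewrite glue_distB ?IH2//; rewrite /B /= -st.
by apply: (glue_distA (@AB n) (A0 _) (@BA n) IH1 (eS n) pe); right; rewrite // /A /= -st.
Qed.

Let tree_dist_rec_stable n m s t : (n <= m)%N -> B n s -> B n t ->
  tree_dist_rec m s t = tree_dist_rec n s t.
Proof.
move=> nm Bs Bt; elim: m nm => [|m IH]; first by rewrite leqn0 => /eqP ->.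
rewrite leq_eqVlt => /predU1P[->//|]; rewrite ltnS => nm /=.
by rewrite glue_distB ?IH//; apply: leq_trans nm.
Qed.

Let tree_distE n s t : B n s -> B n t -> tree_dist s t = tree_dist_rec n s t.
Proof.
move=> Bs Bt; rewrite /tree_dist -(@tree_dist_rec_stable _ n)//.
- by rewrite geq_max; apply/andP.
- by rewrite /B /= leq_maxl.
- by rewrite /B /= leq_maxr.
Qed.

Lemma tree_dist_pseudo : pseudo_on setT tree_dist.
Proof.
split.
- move=> x _; have [[+ _ _] _] := tree_dist_recP (tag x); rewrite (@tree_distE (tag x)); [|exact: leqnn..].
  by apply; exact: leqnn.
- move=> x y _ _; set n := maxn (tag x) (tag y).
  have [Bx By] : B n x /\ B n y by split; rewrite /B /= ?leq_maxl ?leq_maxr.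
  by have [[_ + _] _] := tree_dist_recP n; rewrite !(@tree_distE n)//; apply.
- move=> y x z _ _ _; set n := maxn (tag x) (maxn (tag y) (tag z)).
  have [Bx By Bz] : [/\ B n x, B n y & B n z].
    by rewrite /B /= /n !leq_max !leqnn !orbT.
  by have [[_ _ +] _] := tree_dist_recP n; rewrite !(@tree_distE n)//; apply.
Qed.

Lemma tree_dist_tag s t : tag s = tag t -> tree_dist s t = e s t.
Proof.
move=> st; have [_ h] := tree_dist_recP (tag s).
by rewrite (@tree_distE (tag s)) ?h ?/B//= st.
Qed.

Lemma tree_dist_par j s t : tag s = par j -> tag t = j.+1 ->
  tree_dist s t = e s t.
Proof.
move=> sj tj; have [pB h] := tree_dist_recP j.
rewrite (@tree_distE j.+1) /B//= ?sj ?tj// ?(leq_trans (parE j))//.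
apply: (glue_distAC (@AB j) (A0 _) (@BA j) pB (eS j)) => //.
by move=> u v Au Av; apply: h; [exact: AB|rewrite Au Av].
Qed.

End tree_pseudometric.

(** * Finite nets and completions *)

Section nets.
Context {R : realType} {T : Type} (p : T -> T -> R).

Definition has_net (A : set T) (e : R) : Prop :=
  exists (n : nat) (F : nat -> T),
    forall s, A s -> exists2 k, (k < n)%N & p (F k) s <= e.

Lemma sub_has_net (A B : set T) e : A `<=` B -> has_net B e -> has_net A e.
Proof. by move=> AB [n [F hF]]; exists n, F => s /AB /hF. Qed.

Lemma has_netU (A B : set T) e : has_net A e -> has_net B e -> has_net (A `|` B) e.
Proof.
move=> [n [F hF]] [m [G hG]].
exists (n + m)%N, (fun k => if (k < n)%N then F k else G (k - n)%N) => s [/hF|/hG] [k kn pk].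
  by exists k; [rewrite ltn_addr|rewrite kn].
exists (n + k)%N; first by rewrite ltn_add2l.
by rewrite ltnNge leq_addr /= addKn.
Qed.

Lemma has_net_bigcup (A : nat -> set T) e N :
  (forall i, (i <= N)%N -> has_net (A i) e) ->
  has_net [set s | exists2 i, (i <= N)%N & A i s] e.
Proof.
elim: N => [|N IH] h.
  by apply: sub_has_net (h 0 (leqnn 0)) => s [i]; rewrite leqn0 => /eqP ->.
have hN i : (i <= N)%N -> has_net (A i) e by move=> iN; apply: h; exact: leqW.
have [n [F hF]] := has_netU (IH hN) (h N.+1 (leqnn _)); exists n, F => s [i]; rewrite leq_eqVlt => /predU1P[-> As|iN As].
  by apply: hF; right.
by apply: hF; left; exists i.
Qed.

End nets.

Lemma has_net_image (R : realType) (S T : Type) (p : S -> S -> R) (q : T -> T -> R)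
    (h : S -> T) (A : set S) e :
  (forall x y, q (h x) (h y) = p x y) -> has_net p A e -> has_net q (h @` A) e.
Proof.
move=> hpq [n [F hF]]; exists n, (h \o F) => _ [s /hF[k kn pk] <-].
by exists k; rewrite //= hpq.
Qed.

Lemma ultra_bigcup_lt (T : Type) (F : set_system T) (A : nat -> set T) n :
  UltraFilter F -> F [set s | exists2 k, (k < n)%N & A k s] ->
  exists2 k, (k < n)%N & F (A k).
Proof.
move=> FU; elim: n => [FA|n IH FA].
  by have [s []] := filter_ex FA.
have [FAn|FAn] := in_ultra_setVsetC (A n) FU; first by exists n.
have [|k kn FAk] := IH; last by exists k => //; exact: leqW.
apply: filterS (filterI FA FAn) => s [[k]]; rewrite ltnS leq_eqVlt.
by move=> /predU1P[->//|kn Ak _]; exists k.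
Qed.

Lemma compact_has_net (R : realType) (X : mspace R) (A : set X) (x0 : X) e :
  0 < e -> compact A -> has_net (@mdist R X) A e.
Proof.
move=> e0 cA; apply: contrapT => nA.
(* Without a finite net the complements in [A] of finite unions of balls generate a proper filter; a
   cluster point of it contradicts the member that omits the ball around that point. *)
pose F : set_system X := [set S | exists n (G : nat -> X),
  A `\` [set s | exists2 k, (k < n)%N & mdist (G k) s <= e] `<=` S].
have FF : ProperFilter F.
  split.
    move=> [n [G AG]]; apply: nA; exists n, G => s As.
    by apply: contrapT => h; apply: (AG s).
  split.
  - by exists 0, (fun _ => x0).
  - move=> S S' [n [G AG]] [m [G' AG']].
    exists (n + m)%N, (fun k => if (k < n)%N then G k else G' (k - n)%N).
    move=> s [As h]; split; [apply: AG|apply: AG']; split=> // -[k kn kG]; apply: h.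
      by exists k; [rewrite ltn_addr|rewrite kn].
    exists (n + k)%N; first by rewrite ltn_add2l.
    by rewrite ltnNge leq_addr /= addKn.
  - by move=> S S' SS' [n [G AG]]; exists n, G => s /AG /SS'.
have FA : F A by exists 0, (fun _ => x0) => s [].
have [x [_ /(_ (~` [set s | mdist x s <= e]) (ball x e))]] := cA F FF FA.
case; last by move=> s [/=]; rewrite ballEmdist /= => h /ltW.
  by exists 1, (fun _ => x) => s [_ h] /= hs; apply: h; exists 0.
exact: nbhsx_ballx.
Qed.

Lemma bcm_has_net (R : realType) (X : bcm R) (x : X) r e : 0 < e -> has_net (@mdist R X) (cball x r) e.
Proof. by move=> e0; apply: compact_has_net => //; exact: bcm_compact. Qed.

Section completion.
Context {R : realType} {T : Type} (p : T -> T -> R) (t0 : T).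
Hypothesis pp : pseudo_on setT p.

Let p0 t : p t t = 0. Proof. by case: pp => h _ _; exact: h. Qed.
Let ps s t : p s t = p t s. Proof. by case: pp => _ h _; exact: h. Qed.
Let pt t s u : p s u <= p s t + p t u. Proof. by case: pp => _ _ h; exact: h. Qed.

(* A point of the completion is recorded by its distances to the points of T. *)
Definition dfun : Type :=
  {phi : T -> R | forall e, 0 < e -> exists t, forall s, `|phi s - p t s| <= e}.

Definition dfun_dist (phi psi : dfun) : R :=
  sup [set `|sval phi s - sval psi s| | s in setT].

Let pdist_le t t' s : `|p t s - p t' s| <= p t t'.
Proof.
by have := pt t' t s; have := pt t t' s; rewrite (ps t' t) ler_norml; lra.
Qed.

Let dfun_ub (phi psi : dfun) : has_ubound [set `|sval phi s - sval psi s| | s in setT].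
Proof.
case: phi psi => [phi hphi] [psi hpsi] /=.
have [t ht] := hphi 1 ltr01; have [t' ht'] := hpsi 1 ltr01.
exists (1 + p t t' + 1) => _ [s _ <-].
have := ht s; have := ht' s; have := pdist_le t t' s.
by rewrite !ler_norml; lra.
Qed.

Let dfun_le (phi psi : dfun) s : `|sval phi s - sval psi s| <= dfun_dist phi psi.
Proof. by apply: ub_le_sup; [exact: dfun_ub|exists s]. Qed.

Let dfun_ge (phi psi : dfun) m : (forall s, `|sval phi s - sval psi s| <= m) ->
  dfun_dist phi psi <= m.
Proof.
move=> h; apply: ge_sup; first by exists `|sval phi t0 - sval psi t0|, t0.
by move=> _ [s _ <-].
Qed.

Lemma dfun_metric : is_metric dfun_dist.
Proof.
split.
- move=> x; apply/eqP; rewrite eq_le; apply/andP; split.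
    by apply: dfun_ge => s; rewrite subrr normr0.
  by apply: le_trans (dfun_le x x t0).
- move=> [phi hphi] [psi hpsi] d0.
  have fg : phi = psi.
    apply/funext => s; apply/eqP; rewrite -subr_eq0 -normr_le0 -d0.
    exact: (dfun_le (exist _ phi hphi) (exist _ psi hpsi)).
  by subst psi; congr exist; exact: Prop_irrelevance.
- move=> x y; apply/eqP; rewrite eq_le; apply/andP; split; apply: dfun_ge => s;
    rewrite distrC; exact: dfun_le.
- move=> y x z; apply: dfun_ge => s.
  apply: le_trans (lerD (dfun_le x y s) (dfun_le y z s)).
  exact: ler_distD.
Qed.

Definition dfun_mspace := MSpace dfun_metric.

Lemma dfun_of_subproof t e : 0 < e -> exists t', forall s, `|p t s - p t' s| <= e.
Proof. by move=> e0; exists t => s; rewrite subrr normr0 ltW. Qed.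

Definition dfun_of t : dfun_mspace := exist _ (p t) (dfun_of_subproof t).

Lemma dfun_of_mdist s t : mdist (dfun_of s) (dfun_of t) = p s t.
Proof.
apply/eqP; rewrite eq_le; apply/andP; split; first by apply: dfun_ge => u; exact: pdist_le.
apply: le_trans (dfun_le (dfun_of s) (dfun_of t) t); rewrite /= p0 subr0.
exact: ler_norm.
Qed.

Let dfun_near (phi : dfun_mspace) e : 0 < e -> exists t, mdist (dfun_of t) phi <= e.
Proof.
move=> e0; have [t ht] := proj2_sig phi e e0.
by exists t; apply: dfun_ge => s; rewrite distrC; exact: ht.
Qed.

Hypothesis tb : forall r e, 0 < e -> has_net p [set t | p t0 t <= r] e.

Let dfun_has_net (x : dfun_mspace) r e : 0 < e ->
  has_net (@mdist R dfun_mspace) (cball x r) e.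
Proof.
move=> e0; have e20 : 0 < e / 2 by lra.
have [n [F hF]] := tb (mdist (dfun_of t0) x + r + e / 2) e20.
exists n, (dfun_of \o F) => y xy.
have [t ty] := dfun_near y e20.
have [|k kn Fk] := hF t.
  rewrite /= -dfun_of_mdist.
  have := metric_triangle (dfun_of t0) y (dfun_of t).
  have := metric_triangle (dfun_of t0) x y.
  rewrite (metric_sym y); move: xy ty; rewrite /cball /=; lra.
exists k => //=; have := metric_triangle (dfun_of (F k)) (dfun_of t) y.
by rewrite dfun_of_mdist; move: Fk ty; lra.
Qed.

(** At every scale [2 ^- n] an ultrafilter on a ball selects one point of a finite net, hence a
    point [c n] of [T] up to that error. The [c n] are Cauchy, and their limit is the limit of the
    ultrafilter. *)
Lemma dfun_compact (x : dfun_mspace) r : compact (cball x r).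
Proof.
rewrite compact_ultra => F FU FA.
have hc n : exists t, F [set y | mdist (dfun_of t) y <= 2 ^- n].
  have n0 : 0 < 2 ^- n / 2 :> R by rewrite divr_gt0// invr_gt0 exprn_gt0.
  have [m [G hG]] := dfun_has_net x r n0.
  have [|k kn Fk] := @ultra_bigcup_lt _ F (fun k => [set s | mdist (G k) s <= 2 ^- n / 2]) m FU.
    by apply: filterS FA => s /hG.
  have [t tG] := dfun_near (G k) n0; exists t; apply: filterS Fk => y /=.
  have := metric_triangle (dfun_of t) (G k) y; lra.
pose c n := projT1 (cid (hc n)).
have cF n : F [set y | mdist (dfun_of (c n)) y <= 2 ^- n] by rewrite /c; case: cid.
have cc n m : p (c n) (c m) <= 2 ^- n + 2 ^- m.
  have [y [yn ym]] := filter_ex (filterI (cF n) (cF m)).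
  rewrite -dfun_of_mdist; apply: le_trans (metric_triangle _ y _) _.
  by rewrite (metric_sym y) lerD.
(* The limit of [p (c n) s], written as an infimum: by [cc] each [p (c m) s] is within [2 ^- m] of
   it. *)
pose phi s := inf [set p (c n) s + 2 ^- n | n in setT].
have philb s m : lbound [set p (c n) s + 2 ^- n | n in setT] (p (c m) s - 2 ^- m).
  move=> _ [n _ <-]; have := cc m n; have := pt (c n) (c m) s; lra.
have phiE m s : `|phi s - p (c m) s| <= 2 ^- m.
  have h1 : phi s <= p (c m) s + 2 ^- m.
    by apply: ge_inf; [exists (p (c m) s - 2 ^- m); exact: philb|exists m].
  have h2 : p (c m) s - 2 ^- m <= phi s.
    by apply: lb_le_inf; [exists (p (c m) s + 2 ^- m), m|exact: philb].
  by rewrite ler_norml; lra.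
have small e : 0 < e -> exists n, 2 ^- n <= e :> R.
  move=> e0; have /cvgrPdist_le/(_ _ e0)[n _ /(_ n (leqnn _))] :
    (2^-1 ^+ n : R) @[n --> \oo] --> (0 : R).
    by apply: cvg_expr; rewrite ger0_norm//; lra.
  by rewrite sub0r normrN exprVn ger0_norm ?invr_ge0 ?exprn_ge0//; exists n.
have hphi e : 0 < e -> exists t, forall s, `|phi s - p t s| <= e.
  move=> /small[n ne]; exists (c n) => s; exact: le_trans (phiE n s) ne.
pose Phi : dfun_mspace := exist _ phi hphi.
have cPhi n : mdist (dfun_of (c n)) Phi <= 2 ^- n.
  by apply: dfun_ge => s; rewrite distrC; exact: phiE.
have FPhi e : 0 < e -> F (ball Phi e).
  move=> e0; have [n ne] := small (e / 3) ltac:(lra).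
  apply: filterS (cF n) => y /=; rewrite ballEmdist /=.
  have := metric_triangle Phi (dfun_of (c n)) y; have := cPhi n.
  rewrite (metric_sym Phi (dfun_of _)); lra.
exists Phi; split.
  rewrite /cball /=; apply/ler_addgt0Pr => e e0.
  have [y [xy ye]] := filter_ex (filterI FA (FPhi e e0)).
  move: xy ye; rewrite /cball ballEmdist /= => xy.
  have := metric_triangle x y Phi; rewrite (metric_sym y Phi); lra.
move=> S /nbhs_ballP[e /= e0 eS]; apply: filterS eS _; exact: FPhi.
Qed.

Theorem pseudo_completion :
  exists (W : rbcm R) (h : T -> W),
    (forall s t, mdist (h s) (h t) = p s t) /\ h t0 = root W.
Proof.
exists (@Rbcm R (@Bcm R dfun_mspace (inhabits (dfun_of t0)) dfun_compact) (dfun_of t0)).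
by exists dfun_of; split=> //; exact: dfun_of_mdist.
Qed.

End completion.

(** * Gluing rooted bcm spaces *)

Section fclose.
Context {R : realType}.

(* Unlike fell_dist, this asks nothing about the spheres of radius e^-1, where
   restricting both sets to the ball would create boundary effects. *)
Definition fclose (Z : rbcm R) (A B : set Z) (e : R) : Prop :=
  A `&` cball (root Z) e^-1 `<=` thickening B e /\
  B `&` cball (root Z) e^-1 `<=` thickening A e.

Lemma fclose_le (Z : rbcm R) (A B : set Z) e e' :
  0 < e -> e <= e' -> fclose A B e -> fclose A B e'.
Proof.
move=> e0 ee' [AB BA]; have e'0 := lt_le_trans e0 ee'.
have h z : cball (root Z) e'^-1 z -> cball (root Z) e^-1 z.
  by rewrite /cball /= => /le_trans; apply; rewrite lef_pV2.
split=> z [Az /h zr].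
  by have [y By zy] := AB z (conj Az zr); exists y => //; exact: le_trans ee'.
by have [y By zy] := BA z (conj Az zr); exists y => //; exact: le_trans ee'.
Qed.

Lemma fclose_sym (Z : rbcm R) (A B : set Z) e : fclose A B e -> fclose B A e.
Proof. by case. Qed.

Lemma fclose_refl (Z : rbcm R) (A : set Z) e : 0 < e -> fclose A A e.
Proof. by move=> e0; split=> z [Az _]; exists z => //; rewrite mdistxx ltW. Qed.

Lemma fcloseP (X Y Z : rbcm R) (f : risoemb X Z) (g : risoemb Y Z) e :
  fclose (range f) (range g) e <->
  (forall x, mdist (root X) x <= e^-1 -> exists y, mdist (f x) (g y) <= e) /\
  (forall y, mdist (root Y) y <= e^-1 -> exists x, mdist (f x) (g y) <= e).
Proof.
split=> -[h1 h2]; split.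
- move=> x xr; have [|_ [y _ <-] fg] := h1 (f x); last by exists y.
  by split; [exists x|rewrite /cball /= -(risoemb_root f) isoemb_mdist].
- move=> y yr; have [|_ [x _ <-] fg] := h2 (g y); last by exists x; rewrite metric_sym.
  by split; [exists y|rewrite /cball /= -(risoemb_root g) isoemb_mdist].
- move=> _ [[x _ <-]]; rewrite /cball /= -(risoemb_root f) isoemb_mdist => /h1[y xy].
  by exists (g y) => //; exists y.
- move=> _ [[y _ <-]]; rewrite /cball /= -(risoemb_root g) isoemb_mdist => /h2[x xy].
  by exists (f x); [exists x|rewrite metric_sym].
Qed.

End fclose.

Section tree_glue.
Context {R : realType} (X Z : nat -> rbcm R) (par : nat -> nat).
Variables (f : forall j, risoemb (X (par j)) (Z j))
          (g : forall j, risoemb (X j.+1) (Z j)).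
Hypothesis parE : forall j, (par j <= j)%N.

Let fam i : Type := X i.
Definition tree_sum : Type := {i : nat & fam i}.
Definition tree_inj i (x : X i) : tree_sum := Tagged fam x.

(** Meaningful only for points of the two pieces that meet in [Z j]; a point of any other piece goes
    to the root by default. *)
Let into j (s : tree_sum) : Z j :=
  if tag s == j.+1 then g j (tagged_as (tree_inj (root (X j.+1))) s)
  else f j (tagged_as (tree_inj (root (X (par j)))) s).

(** For pieces [par j] and [j.+1] the larger tag is [j.+1], because [par j <= j]; its predecessor
    names the space [Z j] in which to measure. *)
Definition tree_edge (s t : tree_sum) : R :=
  if tag s == tag t then mdist (tagged s : X (tag s)) (tagged_as s t)
  else mdist (into (maxn (tag s) (tag t)).-1 s) (into (maxn (tag s) (tag t)).-1 t).

Let par_neq j : (par j == j.+1) = false.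
Proof. by apply/eqP => h; have := parE j; rewrite h ltnn. Qed.

Let tagged_as_inj i (x y : X i) : tagged_as (tree_inj y) (tree_inj x) = x.
Proof. exact: (@tagged_asE _ fam (tree_inj y)). Qed.

Let into_g j (y : X j.+1) : into j (tree_inj y) = g j y.
Proof. by rewrite /into eqxx tagged_as_inj. Qed.

Let into_f j (x : X (par j)) : into j (tree_inj x) = f j x.
Proof. by rewrite /into /= par_neq tagged_as_inj. Qed.

Let edge_tag i (x y : X i) : tree_edge (tree_inj x) (tree_inj y) = mdist x y.
Proof. by rewrite /tree_edge /= eqxx tagged_as_inj. Qed.

Let edge_into j s t : tag s = par j \/ tag s = j.+1 -> tag t = par j \/ tag t = j.+1 ->
  tree_edge s t = mdist (into j s) (into j t).
Proof.
case: s t => [i x] [k y] /= [] ij [] kj; subst i k;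
  rewrite -?/(tree_inj x) -?/(tree_inj y).
- by rewrite edge_tag !into_f isoemb_mdist.
- by rewrite /tree_edge /= par_neq (maxn_idPr _)// leqW.
- by rewrite /tree_edge /= eq_sym par_neq (maxn_idPl _)// leqW.
- by rewrite edge_tag !into_g isoemb_mdist.
Qed.

Let edgeS j : pseudo_on ([set s | tag s = par j] `|` [set s | tag s = j.+1]) tree_edge.
Proof.
pose q s t := mdist (into j s) (into j t).
apply: (@eq_pseudo_on _ _ _ q) => [x y Ax Ay|]; first exact: edge_into.
split=> *; [exact: mdistxx|exact: metric_sym|exact: metric_triangle].
Qed.

Let edge0 : pseudo_on [set s | tag s = 0%N] tree_edge.
Proof.
by apply: sub_pseudo_on (edgeS 0) => s /= s0; left; have := parE 0; rewrite leqn0 => /eqP ->.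
Qed.

Definition tree_gdist := tree_dist tag par tree_edge.

Let tag_neq0 i : [set s : tree_sum | tag s = i] !=set0.
Proof. by exists (tree_inj (root (X i))). Qed.

Lemma tree_gdist_pseudo : pseudo_on setT tree_gdist.
Proof. exact: tree_dist_pseudo. Qed.

Lemma tree_gdist_tag i (x y : X i) :
  tree_gdist (tree_inj x) (tree_inj y) = mdist x y.
Proof. by rewrite -edge_tag; exact: tree_dist_tag. Qed.

Lemma tree_gdist_edge j (x : X (par j)) (y : X j.+1) :
  tree_gdist (tree_inj x) (tree_inj y) = mdist (f j x) (g j y).
Proof.
rewrite /tree_gdist (@tree_dist_par _ _ _ _ _ _ _ _ _ j)//.
rewrite (@edge_into j); [|by left|by right].
by rewrite into_f into_g.
Qed.

Let o := tree_inj (root (X 0)).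

(** Embeddings preserve roots, so each root is at distance 0 from the root of its parent piece;
    strong induction along [par] leads back to piece 0. *)
Lemma tree_gdist_root i (x : X i) : tree_gdist o (tree_inj x) = mdist (root (X i)) x.
Proof.
have [p0 ps pt] := tree_gdist_pseudo.
have {}pt t s u := pt t s u I I I; have {}ps s t := ps s t I I.
suff h : tree_gdist o (tree_inj (root (X i))) = 0.
  apply/eqP; rewrite eq_le -(tree_gdist_tag (root (X i)) x); apply/andP; split.
    by rewrite -[leRHS]add0r -h.
  by rewrite -[leRHS]add0r -[in leRHS]h (ps o).
elim/ltn_ind: i {x} => -[_|i IH]; first by rewrite tree_gdist_tag mdistxx.
apply/eqP; rewrite eq_le (pseudo_on_ge0 tree_gdist_pseudo)// andbT.
rewrite (le_trans (pt (tree_inj (root (X (par i)))) _ _))//.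
by rewrite IH ?ltnS// tree_gdist_edge !risoemb_root mdistxx addr0.
Qed.

Theorem tree_glue :
  (forall r e, 0 < e -> exists N, forall i (x : X i), mdist (root (X i)) x <= r ->
     exists i' (x' : X i'), (i' <= N)%N /\ tree_gdist (tree_inj x') (tree_inj x) <= e) ->
  exists (W : rbcm R) (h : forall i, risoemb (X i) W),
    forall i j (x : X i) (y : X j), mdist (h i x) (h j y) = tree_gdist (tree_inj x) (tree_inj y).
Proof.
move=> hN; have [p0 ps pt] := tree_gdist_pseudo.
have {}pt t s u := pt t s u I I I; have {}ps s t := ps s t I I.
have net r e : 0 < e -> has_net tree_gdist [set t | tree_gdist o t <= r] e.
  move=> e0; have e20 : 0 < e / 2 by lra.
  have [N hN'] := hN r _ e20.
  (* The radius is [r + e / 2] because the substitute [x'] of a point of norm at most [r] may lie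
     slightly further out. *)
  have [//|n [F hF]] := @has_net_bigcup R _ tree_gdist
    (fun i => @tree_inj i @` cball (root (X i)) (r + e / 2)) (e / 2) N.
    move=> i iN; apply: (has_net_image (p := @mdist R (X i))).
      by move=> x y; rewrite tree_gdist_tag.
    exact: bcm_has_net.
  exists n, F => -[i x]; rewrite -/(tree_inj x) /= tree_gdist_root => xr.
  have [i' [x' [i'N x'x]]] := hN' i x xr.
  have [|k kn Fk] := hF (tree_inj x').
    exists i' => //; exists x' => //; rewrite /cball /=.
    have := pt (tree_inj x) o (tree_inj x').
    by rewrite !tree_gdist_root (ps (tree_inj x) (tree_inj x')); lra.
  exists k => //; have := pt (tree_inj x') (F k) (tree_inj x). lra.
have [W [h [hd hr]]] := pseudo_completion tree_gdist_pseudo net.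
have hi i (x y : X i) : mdist (h (tree_inj x)) (h (tree_inj y)) = mdist x y.
  by rewrite hd tree_gdist_tag.
have hroot i : IsoEmb (hi i) (root (X i)) = root W.
  by apply: mdist_positivity; rewrite /= -hr hd ps tree_gdist_root mdistxx.
by exists W, (fun i => RIsoEmb (hroot i)) => i j x y /=; rewrite hd.
Qed.

End tree_glue.

Section real_facts.
Context {R : realType}.

Lemma exp2N_gt0 n : 0 < 2 ^- n :> R.
Proof. by rewrite invr_gt0 exprn_gt0. Qed.

Lemma exp2NS n : 2 ^- n = 2 * 2 ^- n.+1 :> R.
Proof. by rewrite exprS invfM mulrA mulfV ?mul1r// pnatr_eq0. Qed.

Lemma exp2N_le1 n : 2 ^- n <= 1 :> R.
Proof. by rewrite invf_le1 ?exprn_gt0// exprn_ege1// ler1n. Qed.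

Lemma exp2N_small (e : R) : 0 < e -> exists N, forall n, (N <= n)%N -> 2 ^- n <= e.
Proof.
move=> e0; have /cvgrPdist_le/(_ _ e0)[N _ hN] :
    (2^-1 ^+ n : R) @[n --> \oo] --> (0 : R).
  by apply: cvg_expr; rewrite ger0_norm//; lra.
exists N => n /hN; rewrite sub0r normrN exprVn ger0_norm // ltW // exp2N_gt0.
Qed.

Lemma exp2_large (r : R) : exists N, forall n, (N <= n)%N -> r <= 2 ^+ n.
Proof.
have r0 : 0 < (Num.max r 1)^-1 by rewrite invr_gt0 lt_max ltr01 orbT.
have [N hN] := exp2N_small r0; exists N => n /hN; rewrite lef_pV2 ?posrE ?exprn_gt0 ?lt_max ?ltr01 ?orbT//.
by rewrite ge_max => /andP[].
Qed.

End real_facts.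

Section glueings.
Context {R : realType}.

Theorem star_glue (X : rbcm R) (Y Z : nat -> rbcm R)
    (f : forall j, risoemb X (Z j)) (g : forall j, risoemb (Y j) (Z j)) :
  (forall e, 0 < e -> exists N, forall j, (N <= j)%N ->
     fclose (range (f j)) (range (g j)) e) ->
  exists (W : rbcm R) (h : risoemb X W) (k : forall j, risoemb (Y j) W),
    forall j x y, mdist (h x) (k j y) = mdist (f j x) (g j y).
Proof.
move=> hfg; pose X' i := if i is j.+1 then Y j else X.
pose gd := @tree_gdist R X' Z (fun _ => 0%N) f g.
have par0 : forall j : nat, (0 <= j)%N by [].
have [|W [h hE]] := @tree_glue R X' Z (fun _ => 0%N) f g par0.
  (* Closeness at scale [e'] is closeness within [e] on a ball of radius at least [r], so all late
     arms are absorbed by the centre, which is piece 0. *)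
  move=> r e e0; pose e' := Num.min e (Num.max r 1)^-1.
  have e'0 : 0 < e' by rewrite lt_min e0 invr_gt0 lt_max ltr01 orbT.
  have [N hN] := hfg _ e'0; exists N => i x xr; case: (leqP i N) => [iN|].
    by exists i, x; rewrite tree_gdist_tag// mdistxx ltW.
  case: i x xr => [//|i] x xr; rewrite ltnS => /hN /fcloseP[_ /(_ x)[]].
    rewrite (le_trans xr)// (@le_trans _ _ (Num.max r 1)) ?le_max ?lexx//.
    by rewrite -[leLHS]invrK lef_pV2 ?posrE ?invr_gt0 ?lt_max ?ltr01 ?orbT// ge_min lexx orbT.
  move=> y xy; exists 0%N, y; split => //.
  by rewrite (@tree_gdist_edge _ X' Z (fun _ => 0%N))// (le_trans xy)// ge_min lexx.
exists W, (h 0%N), (fun j => h j.+1) => j x y.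
exact: (etrans (hE 0%N j.+1 x y) (@tree_gdist_edge _ X' Z (fun _ => 0%N) f g par0 j x y)).
Qed.

(** A star whose arms from index 2 on are trivial: copies of the centre [X], linked by the
    identity. *)
Theorem two_glue (X Y Y' Z Z' : rbcm R) (f : risoemb X Z) (g : risoemb Y Z)
    (f' : risoemb X Z') (g' : risoemb Y' Z') :
  exists (W : rbcm R) (h : risoemb X W) (k : risoemb Y W) (k' : risoemb Y' W),
    (forall x y, mdist (h x) (k y) = mdist (f x) (g y)) /\
    (forall x y, mdist (h x) (k' y) = mdist (f' x) (g' y)).
Proof.
pose id_X := @RIsoEmb R X X (isoemb_id X) erefl.
pose Y_ i := match i with 0 => Y | 1 => Y' | _ => X end.
pose Z_ i := match i with 0 => Z | 1 => Z' | _ => X end.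
pose f_ i : risoemb X (Z_ i) := match i with 0 => f | 1 => f' | _ => id_X end.
pose g_ i : risoemb (Y_ i) (Z_ i) := match i with 0 => g | 1 => g' | _ => id_X end.
have [|W [h [k hk]]] := @star_glue X Y_ Z_ f_ g_.
  by move=> e e0; exists 2%N => -[|[|j]]//= _; exact: fclose_refl.
exists W, h, (k 0%N), (k 1%N); split=> x y; [exact: (hk 0%N)|exact: (hk 1%N)].
Qed.

Section chain.
Variables (X Z : nat -> rbcm R).
Variables (f : forall j, risoemb (X j) (Z j)) (g : forall j, risoemb (X j.+1) (Z j)).
Hypothesis fg : forall j, fclose (range (f j)) (range (g j)) (2 ^- j).

Let gd := @tree_gdist R X Z id f g.
Let gp : pseudo_on setT gd. Proof. exact: tree_gdist_pseudo. Qed.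
Let gs s t : gd s t = gd t s. Proof. by case: gp => _ h _; exact: h. Qed.
Let gt t s u : gd s u <= gd s t + gd t u. Proof. by case: gp => _ _ h; exact: h. Qed.
Let gtag i (x y : X i) : gd (tree_inj x) (tree_inj y) = mdist x y.
Proof. exact: tree_gdist_tag. Qed.
Let gedge j (x : X j) (y : X j.+1) : gd (tree_inj x) (tree_inj y) = mdist (f j x) (g j y).
Proof. exact: (@tree_gdist_edge _ _ _ id). Qed.
Let groot i (x : X i) : gd (tree_inj (root (X 0%N))) (tree_inj x) = mdist (root (X i)) x.
Proof. exact: (@tree_gdist_root _ _ _ id). Qed.

Let norm_le i j (x : X i) (y : X j) :
  mdist (root (X j)) y <= mdist (root (X i)) x + gd (tree_inj x) (tree_inj y).
Proof. by rewrite -!groot. Qed.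

Let pow_le N k : 2 ^+ N <= (2 ^- (k + N))^-1 :> R.
Proof. by rewrite invrK ler_weXn2l ?leq_addl// ler1n. Qed.

Let pow2S N k : 2 ^- (k + N) = 2 * 2 ^- (k.+1 + N) :> R.
Proof. exact: exp2NS. Qed.

(** The steps from [N] to [k + N] sum to [2 * 2 ^- N - 2 * 2 ^- (k + N)]. This is at most 2, so a
    point of norm at most [2 ^+ N - 2] stays within the radius [2 ^+ N], where every later link is
    effective. *)
Let up N k (x : X N) : mdist (root (X N)) x <= 2 ^+ N - 2 ->
  exists x' : X (k + N)%N, gd (tree_inj x) (tree_inj x') <= 2 * 2 ^- N - 2 * 2 ^- (k + N).
Proof.
move=> xN; elim: k => [|k [x' xx']]; first by exists x; rewrite gtag mdistxx add0n subrr.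
have /fcloseP[fgl _] := fg (k + N); have [|y x'y] := fgl x'.
  apply: le_trans (pow_le N k); have := norm_le x x'.
  have := exp2N_le1 (R := R) N; have := exp2N_gt0 (R := R) (k + N); lra.
exists y; apply: le_trans (gt (tree_inj x') _ _) _.
rewrite gedge; move: xx' x'y; have := pow2S N k; lra.
Qed.

(** The extra [2 * 2 ^- (k + N)] in the radius absorbs the growth of the norm: one step down adds
    [2 ^- (k + N)], which turns the bound for [k.+1] into the bound for [k]. *)
Let down N k (x : X (k + N)%N) : mdist (root (X (k + N)%N)) x <= 2 ^+ N - 2 + 2 * 2 ^- (k + N) ->
  exists x' : X N, gd (tree_inj x') (tree_inj x) <= 2 * 2 ^- N - 2 * 2 ^- (k + N).
Proof.
elim: k x => [|k IH] x xr; first by exists x; rewrite gtag mdistxx add0n subrr.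
have /fcloseP[_ fgr] := fg (k + N); have [|y yx] := fgr x.
  apply: le_trans xr _; apply: le_trans (pow_le N k).
  by have := exp2N_le1 (R := R) (k.+1 + N); lra.
have [|x' x'y] := IH y.
  by have := norm_le x y; rewrite gs gedge; move: xr yx; have := pow2S N k; lra.
exists x'; apply: le_trans (gt (tree_inj y) _ _) _.
rewrite gedge; move: x'y yx; have := pow2S N k; lra.
Qed.

Theorem chain_glue :
  exists (W : rbcm R) (h : forall i, risoemb (X i) W),
  [/\ forall j x y, mdist (h j x) (h j.+1 y) = mdist (f j x) (g j y),
      forall N n (x : X N), (N <= n)%N -> mdist (root (X N)) x <= 2 ^+ N - 2 ->
        exists x' : X n, mdist (h N x) (h n x') <= 2 * 2 ^- N &
      forall N n (x : X n), (N <= n)%N -> mdist (root (X n)) x <= 2 ^+ N - 2 ->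
        exists x' : X N, mdist (h N x') (h n x) <= 2 * 2 ^- N].
Proof.
have [|W [h hE]] := @tree_glue R X Z id f g (fun=> leqnn _).
  move=> r e e0; have e20 : 0 < e / 2 by lra.
  have [N1 hN1] := exp2N_small e20; have [N2 hN2] := exp2_large (r + 2).
  pose N := maxn N1 N2; exists N => i x xr.
  case: (leqP i N) => [iN|/ltnW Ni].
    by exists i, x; rewrite tree_gdist_tag// mdistxx ltW.
  move: x xr; rewrite -(subnK Ni) => x xr; have [|x' x'x] := @down N (i - N)%N x.
    have := hN2 N (leq_maxr _ _); have := exp2N_gt0 (R := R) (i - N + N); move: xr; lra.
  exists N, x'; split=> //; move: x'x; rewrite -/gd.
  have := hN1 N (leq_maxl _ _); have := exp2N_gt0 (R := R) (i - N + N); lra.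
exists W, h; split.
- by move=> j x y; rewrite hE; exact: gedge.
- move=> N n x Nn xr; rewrite -(subnK Nn); have [x' xx'] := @up N (n - N)%N x xr.
  by exists x'; rewrite hE; move: xx'; have := exp2N_gt0 (R := R) (n - N + N); rewrite -/gd; lra.
- move=> N n x Nn; move: x; rewrite -(subnK Nn) => x xr.
  have [|x' x'x] := @down N (n - N)%N x.
    by have := exp2N_gt0 (R := R) (n - N + N); move: xr; lra.
  by exists x'; rewrite hE; move: x'x; have := exp2N_gt0 (R := R) (n - N + N); rewrite -/gd; lra.
Qed.

End chain.
End glueings.

(** * Subspaces, couplings and Fell convergence *)

Section subspaces.
Context {R : realType}.

Lemma compact_cball_isometric (S : mspace R) (M : bcm R) (i : S -> M) :
  (forall x y, mdist (i x) (i y) = mdist x y) -> closed (range i) ->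
  forall (x : S) r, compact (cball x r).
Proof.
move=> iM ci x r F FF Fx.
have iFx : F (i @^-1` cball (i x) r).
  by apply: filterS Fx => y; rewrite /cball /= iM.
have [y [xy Fy]] := @bcm_compact R M (i x) r (i @ F) (fmap_proper_filter i FF) iFx.
have iF A : F A -> F (i @^-1` (i @` A)) by apply: filterS => s As; exists s.
have [z _ zy] : range i y.
  apply: ci => B yB; have [_ [[s _ <-] Bs]] := Fy _ _ (iF _ Fx) yB.
  by exists (i s); split => //; exists s.
exists z; split; first by move: xy; rewrite -zy /cball /= iM.
move=> A B FA /nbhs_ballP[e /= e0 eB].
have [_ [[s As <-]]] := Fy _ _ (iF _ FA) (nbhsx_ballx y e e0).
rewrite -zy ballEmdist /= iM => zs; exists s; split=> //.
by apply: eB; rewrite ballEmdist.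
Qed.

Lemma subbcm (M : rbcm R) (C : set M) : closed C -> C (root M) ->
  exists (S : rbcm R) (i : risoemb S M), range i = C.
Proof.
move=> cC Cr; pose T := {x : M | C x}; pose d (x y : T) := mdist (sval x) (sval y).
have dm : is_metric d.
  split=> [x|[x Cx] [y Cy] /mdist_positivity /= xy|x y|y x z].
  - exact: mdistxx.
  - by subst y; congr exist; exact: Prop_irrelevance.
  - exact: metric_sym.
  - exact: metric_triangle.
pose S := MSpace dm.
have rC : range (sval : S -> M) = C.
  by apply/seteqP; split=> [_ [[x Cx] _ <-]//|x Cx]; exists (exist _ x Cx).
have cS (x : S) r : compact (cball x r).
  by apply: (@compact_cball_isometric S M sval) => //; rewrite rC.
pose S' := @Rbcm R (@Bcm R S (inhabits (exist _ _ Cr)) cS) (exist _ _ Cr).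
by exists S', (@RIsoEmb R S' M (@IsoEmb R S' M sval (fun _ _ => erefl)) erefl).
Qed.

Lemma isoemb_factor (X U Z : rbcm R) (f : risoemb X Z) (i : risoemb U Z) :
  range f `<=` range i -> exists f1 : risoemb X U, forall x, i (f1 x) = f x.
Proof.
move=> fi; have h x : exists u, i u = f x.
  by have [u _ uf] := fi (f x) (ex_intro2 _ _ x I erefl); exists u.
pose f1 x := projT1 (cid (h x)).
have f1E x : i (f1 x) = f x by rewrite /f1; case: cid.
have f1d x y : mdist (f1 x) (f1 y) = mdist x y.
  by rewrite -(isoemb_mdist i) !f1E isoemb_mdist.
have f1r : IsoEmb f1d (root X) = root U.
  by apply: (@isoemb_inj _ _ _ i); rewrite /= f1E !risoemb_root.
by exists (RIsoEmb f1r).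
Qed.

(** The union of the two images in [Z], taken as a space [U], embeds in [W] too. The map is well
    defined because a coincidence [f x = g y] is a cross distance 0, whence [f' x = g' y]. *)
Lemma coupling_factor (X Y Z W : rbcm R) (f : risoemb X Z) (g : risoemb Y Z)
    (f' : risoemb X W) (g' : risoemb Y W) :
  (forall x y, mdist (f x) (g y) = mdist (f' x) (g' y)) ->
  exists (U : rbcm R) (i : risoemb U Z) (k : risoemb U W)
    (f1 : risoemb X U) (g1 : risoemb Y U),
    [/\ forall x, i (f1 x) = f x, forall y, i (g1 y) = g y,
        forall x, k (f1 x) = f' x & forall y, k (g1 y) = g' y].
Proof.
move=> fg; have [||U [i iC]] := @subbcm Z (range f `|` range g).
- by apply: closedU; exact: closed_range_isoemb.
- by left; exists (root X) => //; exact: risoemb_root.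
have [|f1 f1E] := @isoemb_factor X U Z f i; first by rewrite iC => z; left.
have [|g1 g1E] := @isoemb_factor Y U Z g i; first by rewrite iC => z; right.
have ex u : exists w, (forall x, f1 x = u -> w = f' x) /\ (forall y, g1 y = u -> w = g' y).
  have [[x _ xu]|[y _ yu]] : (range f `|` range g) (i u) by rewrite -iC; exists u.
  - have {}xu : f1 x = u by apply: (@isoemb_inj _ _ _ i); rewrite f1E.
    exists (f' x); split=> [x' x'u|y' y'u].
      by congr (f' _); apply: (@isoemb_inj _ _ _ f1); rewrite x'u.
    by apply: mdist_positivity; rewrite -fg -f1E -g1E xu y'u mdistxx.
  - have {}yu : g1 y = u by apply: (@isoemb_inj _ _ _ i); rewrite g1E.
    exists (g' y); split=> [x' x'u|y' y'u].
      by apply: mdist_positivity; rewrite metric_sym -fg -f1E -g1E x'u yu mdistxx.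
    by congr (g' _); apply: (@isoemb_inj _ _ _ g1); rewrite y'u.
pose k u := projT1 (cid (ex u)).
have kf x : k (f1 x) = f' x by rewrite /k; case: cid => w /= [h _]; exact: h.
have kg y : k (g1 y) = g' y by rewrite /k; case: cid => w /= [_ h]; exact: h.
have cov u : (exists x, f1 x = u) \/ (exists y, g1 y = u).
  have [[x _ xu]|[y _ yu]] : (range f `|` range g) (i u) by rewrite -iC; exists u.
  - by left; exists x; apply: (@isoemb_inj _ _ _ i); rewrite f1E.
  - by right; exists y; apply: (@isoemb_inj _ _ _ i); rewrite g1E.
have kd u v : mdist (k u) (k v) = mdist u v.
  have [[x <-]|[x <-]] := cov u; have [[y <-]|[y <-]] := cov v;
    rewrite ?kf ?kg ?isoemb_mdist//.
  - by rewrite -fg -f1E -g1E isoemb_mdist.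
  - by rewrite metric_sym -fg -f1E -g1E isoemb_mdist metric_sym.
have kr : IsoEmb kd (root U) = root W by rewrite /= -(risoemb_root f1) kf risoemb_root.
by exists U, i, (RIsoEmb kr), f1, g1.
Qed.

Lemma str_map_comp_eq (tau : structure R) (X Y Z : bcm R) (i : isoemb Y Z)
    (f1 : isoemb X Y) (f : isoemb X Z) (a : tau X) :
  (forall x, i (f1 x) = f x) -> str_map f a = str_map i (str_map f1 a).
Proof.
move=> h; rewrite -str_comp; have -> // : f = isoemb_comp i f1.
by apply: isoemb_ext => x /=; rewrite h.
Qed.

(** Both sides equal the distance of the marks in the common subspace [U], because root-preserving
    embeddings preserve the metrization. *)
Lemma srm_coupling (tau : structure R) (S : srm tau) (X Y Z W : rbcm R)
    (f : risoemb X Z) (g : risoemb Y Z) (f' : risoemb X W) (g' : risoemb Y W)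
    (a : tau X) (b : tau Y) :
  (forall x y, mdist (f x) (g y) = mdist (f' x) (g' y)) ->
  srm_dist S Z (str_map f a) (str_map g b) =
  srm_dist S W (str_map f' a) (str_map g' b).
Proof.
move=> /coupling_factor[U [i [k [f1 [g1 [fE gE f'E g'E]]]]]].
rewrite (str_map_comp_eq a fE) (str_map_comp_eq b gE).
by rewrite (str_map_comp_eq a f'E) (str_map_comp_eq b g'E) !srm_isometric.
Qed.

End subspaces.

Section fell_convergence.
Context {R : realType}.

Lemma cvg_fell (Y : bcm R) (A : nat -> fell Y) (B : fell Y) :
  (forall K : set Y, compact K -> sval B `&` K = set0 ->
     \forall n \near \oo, sval (A n) `&` K = set0) ->
  (forall U : set Y, open U -> sval B `&` U !=set0 ->
     \forall n \near \oo, sval (A n) `&` U !=set0) ->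
  A n @[n --> \oo] --> B.
Proof.
move=> hK hU S; rewrite nbhsE => -[V [[D' sD' VE] BV] VS].
have [C D'C BC] : (\bigcup_(C in D') C) B by rewrite VE.
have CS : C `<=` S by move=> x Cx; apply: VS; rewrite -VE; exists C.
have [E sE CE] := sD' _ D'C.
apply: (filterS CS); rewrite /= -CE.
apply: (@filter_bigI nat _ E (fun i => [set n | isSubBaseTopological.b i (A n)])).
move=> i iE; have := sE i iE; rewrite inE => Di.
have Bi : isSubBaseTopological.b i B by move: BC; rewrite -CE; apply.
case: Di Bi => [[K cK <-]|[U oU <-]] /= Bi; [exact: hK|exact: hU].
Qed.

(** If ranges of arbitrarily large index met a compact [K], a cluster point of the meeting points
    would lie both in [K] and in the closed set [range h]. *)
Lemma fclose_cvg_fell (X : rbcm R) (Y : nat -> rbcm R) (W : rbcm R) (h : risoemb X W)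
    (k : forall n, risoemb (Y n) W) :
  (forall e, 0 < e -> exists N, forall n, (N <= n)%N ->
     fclose (range h) (range (k n)) e) ->
  fell_range (k n) @[n --> \oo] --> fell_range h.
Proof.
move=> hk; apply: cvg_fell => [K cK hK0|U oU [_ [[x _ <-] Ux]]] /=.
  apply: contrapT => nK.
  have ex n : exists z, K z /\ exists2 m, (n <= m)%N & range (k m) z.
    apply: contrapT => nz; apply: nK; exists n => // m /= nm.
    apply/seteqP; split=> // z [kz Kz]; apply: nz; exists z; split=> //.
    by exists m.
  pose c n := projT1 (cid (ex n)).
  have Kz n : K (c n) by rewrite /c; case: cid => ? /= [].
  have zk n : exists2 m, (n <= m)%N & range (k m) (c n) by rewrite /c; case: cid => ? /= [].
  have Koo : (c @ \oo) K by exists 0%N => // n _; exact: Kz.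
  have [w [Kw wc]] := cK (c @ \oo) _ Koo.
  suff hw : range h w by have : (range h `&` K) w by []; rewrite hK0.
  apply: (@closed_range_isoemb _ _ _ h) => B /nbhs_ballP[e /= e0 eB].
  pose r := mdist (root W) w + 1.
  pose e' := Num.min (e / 2) r^-1.
  have r0 : 0 < r by rewrite ltr_wpDl// mdist_ge0.
  have e'0 : 0 < e' by rewrite lt_min invr_gt0 r0 andbT; lra.
  have [N hN] := hk e' e'0.
  have d0 : 0 < Num.min (e / 2) 1 by rewrite lt_min ltr01 andbT; lra.
  have [_ [[n /= Nn <-] wz]] := wc (c @` [set n | (N <= n)%N])
     _ (ex_intro2 _ _ N I (fun n Nn => ex_intro2 _ _ n Nn erefl)) (nbhsx_ballx w _ d0).
  move: wz; rewrite ballEmdist /= lt_min => /andP[wz1 wz2].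
  have [m nm km] := zk n; have [_ hm] := hN m (leq_trans Nn nm).
  have [|u hu zu] := hm (c n).
    split=> //; rewrite /cball /= (@le_trans _ _ r)//.
      by have := metric_triangle (root W) w (c n); rewrite /r; lra.
    by rewrite -[leLHS]invrK lef_pV2 ?posrE ?invr_gt0// ge_min lexx orbT.
  exists u; split=> //; apply: eB; rewrite ballEmdist /=.
  have := metric_triangle w (c n) u; move: zu; rewrite /e' le_min => /andP[].
  lra.
have /nbhs_ballP[e /= e0 eU] : nbhs (h x) U by apply: open_nbhs_nbhs.
pose r := mdist (root X) x + 1; pose e' := Num.min (e / 2) r^-1.
have r0 : 0 < r by rewrite ltr_wpDl// mdist_ge0.
have e'0 : 0 < e' by rewrite lt_min invr_gt0 r0 andbT; lra.
have [N hN] := hk e' e'0; exists N => // n /= /hN /fcloseP[hx _].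
have [|y xy] := hx x.
  rewrite (@le_trans _ _ r)//; first by rewrite /r; lra.
  by rewrite -[leLHS]invrK lef_pV2 ?posrE ?invr_gt0// ge_min lexx orbT.
exists (k n y); split; first by exists y.
apply: eU; rewrite ballEmdist /=; move: xy; rewrite /e' le_min => /andP[].
lra.
Qed.

End fell_convergence.

(** * Arzela-Ascoli for root-preserving embeddings *)

Section ascoli.
Context {R : realType}.

Lemma ultra_cluster_ball (W : mspace R) (K : set W) (U : set_system nat) (u : nat -> W) :
  UltraFilter U -> compact K -> (forall n, K (u n)) ->
  exists w, forall e, 0 < e -> U [set n | mdist w (u n) < e].
Proof.
move=> UU cK Ku; have UK : U (u @^-1` K) by apply: filterS filterT => n _; exact: Ku.
have [w [_ wc]] := cK (u @ U) (fmap_proper_filter u _) UK.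
exists w => e e0; have [//|Un] := in_ultra_setVsetC [set n | mdist w (u n) < e] UU.
have Uu : U (u @^-1` (u @` ~` [set n | mdist w (u n) < e])).
  by apply: filterS Un => n nw; exists n.
have [_ [[n nw <-]]] := wc _ _ Uu (nbhsx_ballx w e e0).
by rewrite ballEmdist.
Qed.

Lemma filter_forall_lt (T : Type) (F : set_system T) (A : nat -> set T) m :
  Filter F -> (forall j, F (A j)) -> F [set t | forall j, (j < m)%N -> A j t].
Proof.
move=> FF FA; elim: m => [|m IH]; first by apply: filterS filterT.
apply: filterS (filterI IH (FA m)) => t [h Am] j.
by rewrite ltnS leq_eqVlt => /predU1P[->//|]; exact: h.
Qed.

Lemma compact_bounded (X : bcm R) (x : X) (K : set X) :
  compact K -> exists r, K `<=` cball x r.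
Proof.
move=> cK; have [n [F hF]] := compact_has_net x ltr01 cK.
exists (\sum_(i < n) mdist x (F i) + 1) => y /hF[k kn Fk]; rewrite /cball /=.
apply: le_trans (metric_triangle _ (F k) _) _; apply: lerD Fk.
by rewrite (bigD1 (Ordinal kn))//= lerDl; apply: sumr_ge0 => i _; exact: mdist_ge0.
Qed.

Lemma subseq_exists (P : nat -> nat -> Prop) :
  (forall k N, exists2 n, (N <= n)%N & P k n) ->
  exists n_ : nat -> nat, {homo n_ : i j / (i < j)%N} /\ forall k, P k (n_ k).
Proof.
move=> hP; pose c k N := s2val (cid2 (hP k N)).
have cN k N : (N <= c k N)%N := s2valP (cid2 (hP k N)).
have cP k N : P k (c k N) := s2valP' (cid2 (hP k N)).
pose n_ := fix n_ k := if k is j.+1 then c k (n_ j).+1 else c 0%N 0%N.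
exists n_; split; last by case=> [|k]; exact: cP.
by apply: homo_ltn => [|k]; [exact: ltn_trans|exact: cN].
Qed.

(** Roots being preserved, the values [g n y] stay in one compact ball. A limit along an ultrafilter
    finer than [\oo] is taken at all points at once, in place of a diagonal argument; finite nets
    then yield an actual subsequence with a rate. *)
Theorem risoemb_ascoli (Y W : rbcm R) (g : nat -> risoemb Y W) :
  exists (n_ : nat -> nat) (goo : risoemb Y W),
  [/\ {homo n_ : i j / (i < j)%N},
      {family compact, (fun k => g (n_ k) : Y -> W) @ \oo --> (goo : Y -> W)} &
      forall k y, mdist (root Y) y <= 2 ^+ k -> mdist (goo y) (g (n_ k) y) <= 2 ^- k * 3].
Proof.
have [U [UU Uoo]] := ultraFilterLemma (eventually_filter : ProperFilter \oo).
have ex y : exists w, forall e, 0 < e -> U [set n | mdist w (g n y) < e].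
  apply: (@ultra_cluster_ball W (cball (root W) (mdist (root Y) y))) => //.
    exact: bcm_compact.
  by move=> n; rewrite /cball /= -(risoemb_root (g n)) isoemb_mdist.
pose h y := projT1 (cid (ex y)).
have hU y e : 0 < e -> U [set n | mdist (h y) (g n y) < e].
  by move=> e0; rewrite /h; case: cid => w /= ; exact.
have hd y y' : mdist (h y) (h y') = mdist y y'.
  have good e : 0 < e -> exists n, mdist (h y) (g n y) < e / 2 /\ mdist (h y') (g n y') < e / 2.
    move=> e0; have e20 : 0 < e / 2 by rewrite divr_gt0.
    exact: filter_ex (filterI (hU y _ e20) (hU y' _ e20)).
  apply/eqP; rewrite eq_le; apply/andP; split; apply/ler_addgt0Pr => e /good[n [n1 n2]];
    have := isoemb_mdist (g n) y y'.
  - have := metric_triangle (h y) (g n y) (h y').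
    have := metric_triangle (g n y) (g n y') (h y').
    by rewrite (metric_sym (g n y') (h y')); lra.
  - have := metric_triangle (g n y) (h y) (g n y').
    have := metric_triangle (h y) (h y') (g n y').
    by rewrite (metric_sym (g n y) (h y)); lra.
have hr : IsoEmb hd (root Y) = root W.
  apply: mdist_positivity; apply/eqP; rewrite eq_le mdist_ge0 andbT.
  apply/ler_addgt0Pr => e /(hU (root Y))/filter_ex[n /=].
  by rewrite risoemb_root add0r => /ltW.
(* The factor 3 counts the passage from [y] to a net point under [h], from [h] to [g n] at the net
   point, and back to [y] under [g n]. *)
have [|n_ [n_mono n_close]] := @subseq_exists (fun k n => forall y,
    mdist (root Y) y <= 2 ^+ k -> mdist (h y) (g n y) <= 2 ^- k * 3).
  move=> k N; have [m [F hF]] := bcm_has_net (root Y) (2 ^+ k) (exp2N_gt0 (R := R) k).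
  have Ugood : U [set n | forall j, (j < m)%N -> mdist (h (F j)) (g n (F j)) < 2 ^- k].
    apply: (@filter_forall_lt _ U (fun j => [set n | mdist (h (F j)) (g n (F j)) < 2 ^- k])).
    by move=> j; apply: hU; exact: exp2N_gt0.
  have UN : U [set n | (N <= n)%N] by apply: Uoo; exists N.
  have [n [/= Nn hn]] := filter_ex (filterI UN Ugood).
  exists n => // y /hF[j jm Fj].
  have := hn j jm; rewrite /=.
  have := isoemb_mdist (g n) (F j) y; have := hd (F j) y.
  have := metric_triangle (h y) (h (F j)) (g n y).
  have := metric_triangle (h (F j)) (g n (F j)) (g n y).
  by rewrite (metric_sym (h y) (h (F j))); lra.
exists n_, (RIsoEmb hr); split=> //.
apply/fam_cvgP => K cK P /uniform_nbhs[E [entE EP]].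
move: entE; rewrite -entourage_ballE => -[e /= e0 eE].
have [r Kr] := compact_bounded (root Y) cK.
have e40 : 0 < e / 4 by lra.
have [N1 hN1] := exp2N_small e40.
have [N2 hN2] := exp2_large r.
exists (maxn N1 N2) => // k /=; rewrite geq_max => /andP[k1 k2].
apply: EP => y Ky /=; apply: eE => /=; rewrite ballEmdist /=.
apply: (@le_lt_trans _ _ (2 ^- k * 3)); last by have := hN1 k k1; lra.
apply: n_close; exact: le_trans (Kr y Ky) (hN2 k k2).
Qed.

End ascoli.

(** * The metric on marked spaces *)

Section metrizes.
Context {R : realType}.

Lemma metrizes_pseudo (T : topologicalType) (d : T -> T -> R) :
  metrizes d -> pseudo_on setT d.
Proof. by case=> -[d0 _ ds dt] _; split=> // *; exact: dt. Qed.

Lemma metrizes_ball (T : topologicalType) (d : T -> T -> R) (x : T) e :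
  metrizes d -> 0 < e -> nbhs x [set y | d x y < e].
Proof.
move=> [[d0 _ _ dt] dtop] e0; apply: open_nbhs_nbhs; split; last by rewrite /= d0.
apply/dtop => y /= xy; exists (e - d x y); first by rewrite subr_gt0.
by move=> z /= yz; have := dt y x z; lra.
Qed.

Lemma metrizes_cvgP (T : topologicalType) (d : T -> T -> R) (u : nat -> T) (l : T) :
  metrizes d ->
  (forall e, 0 < e -> exists N, forall n, (N <= n)%N -> d l (u n) < e) <->
  u n @[n --> \oo] --> l.
Proof.
move=> dT; split=> [ul|ul e e0].
  move=> B; rewrite nbhsE => -[V [oV Vl] VB].
  have [e e0 eV] := (dT.2 V).1 oV l Vl; have [N hN] := ul e e0.
  by exists N => // n /= /hN ?; apply: VB; exact: eV.
by have [N _ hN] := ul _ (metrizes_ball l dT e0); exists N.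
Qed.

Lemma metrizes_cvg_unique (T : topologicalType) (d : T -> T -> R) (u : nat -> T) (l l' : T) :
  metrizes d -> u n @[n --> \oo] --> l -> u n @[n --> \oo] --> l' -> l = l'.
Proof.
move=> dT /(metrizes_cvgP _ _ dT) h /(metrizes_cvgP _ _ dT) h'.
have [d0 dpos ds dt] := dT.1; apply: dpos; apply/eqP.
rewrite eq_le (pseudo_on_ge0 (metrizes_pseudo dT))// andbT.
apply/ler_addgt0Pr => e e0; have e20 : 0 < e / 2 by rewrite divr_gt0.
have [N hN] := h _ e20; have [N' hN'] := h' _ e20.
have := hN (maxn N N') (leq_maxl _ _); have := hN' (maxn N N') (leq_maxr _ _).
by have := dt (u (maxn N N')) l l'; rewrite (ds (u _) l') add0r; lra.
Qed.

End metrizes.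

Lemma root_mdist_le (R : realType) (X Y W : rbcm R) (k : risoemb X W)
    (h : risoemb Y W) x y :
  mdist (root Y) y <= mdist (root X) x + mdist (k x) (h y).
Proof.
rewrite -(isoemb_mdist h) -(isoemb_mdist k) !risoemb_root.
exact: metric_triangle.
Qed.

Lemma dependent_choice_ex (T : Type) (U : T -> Type) (P : forall x, U x -> Prop) :
  (forall x, exists u, P x u) -> exists f, forall x, P x (f x).
Proof.
by move=> h; exists (fun x => projT1 (cid (h x))) => x; exact: projT2 (cid (h x)).
Qed.

Section marked_metric.
Context {R : realType} {tau : structure R} (S : srm tau).
Implicit Types x y z : marked tau.

Let Ssym (X : rbcm R) (a b : tau X) : srm_dist S X a b = srm_dist S X b a.
Proof. by have [[_ _ h _] _] := srm_metrizes S X; exact: h. Qed.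

Definition linked (e : R) x y : Prop :=
  exists (Z : rbcm R) (f : risoemb (mk_space x) Z) (g : risoemb (mk_space y) Z),
    fclose (range f) (range g) e /\
    srm_dist S Z (str_map f (mk_mark x)) (str_map g (mk_mark y)) <= e.

(* Triples that cannot be linked at any scale below 1 are at distance 1; the
   truncation is what makes the triangle inequality hold, see linked_trans. *)
Definition mclose (e : R) x y : Prop := 0 < e /\ (1 <= e \/ linked e x y).

Definition mmdist x y : R := inf [set e | mclose e x y].

Lemma linked_sym e x y : linked e x y -> linked e y x.
Proof.
move=> [Z [f [g [fg ab]]]]; exists Z, g, f; split; first exact: fclose_sym.
by rewrite Ssym.
Qed.

Lemma linked_le e e' x y : 0 < e -> e <= e' -> linked e x y -> linked e' x y.
Proof.
move=> e0 ee' [Z [f [g [fg ab]]]]; exists Z, f, g; split; last exact: le_trans ee'.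
exact: fclose_le fg.
Qed.

(** The reason for [e^-1] as a radius: a point of the ball of radius [(e + e')^-1], displaced by
    [e], is still within reach of the second link. The inverses differ by [e / ((e + e') * e')],
    where both factors of the denominator are at most 1. *)
Let inv_add (e e' : R) : 0 < e -> 0 < e' -> e + e' <= 1 -> (e + e')^-1 + e <= e'^-1.
Proof.
move=> e0 e'0 ee'; have s0 : 0 < e + e' by lra.
have E : e'^-1 - (e + e')^-1 = e * ((e + e')^-1 * e'^-1) by field; rewrite !gt_eqF.
rewrite -lerBrDl E ler_peMr // ?(ltW e0)//.
by rewrite mulr_ege1// invf_ge1//; lra.
Qed.

Lemma linked_trans e e' x y z : 0 < e -> 0 < e' -> e + e' <= 1 ->
  linked e x y -> linked e' y z -> linked (e + e') x z.
Proof.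
move=> e0 e'0 ee' [Z [f [g [/fcloseP[fg gf] ab]]]] [Z' [f' [g' [/fcloseP[fg' gf'] ab']]]].
have [W [h [k [k' [hk hk']]]]] := two_glue g f f' g'.
have h1 : (e + e')^-1 <= e^-1 by rewrite lef_pV2 ?posrE ?addr_gt0//; lra.
have h1' : (e + e')^-1 <= e'^-1 by rewrite lef_pV2 ?posrE ?addr_gt0//; lra.
have h2 := inv_add e0 e'0 ee'.
have h2' : (e + e')^-1 + e' <= e^-1 by rewrite (addrC e); apply: inv_add; rewrite // addrC.
exists W, k, k'; split.
  apply/fcloseP; split=> [u ur|w wr].
    have [|v uv] := fg u; first lra.
    have [|w vw] := fg' v.
      by have := root_mdist_le k h u v; rewrite (metric_sym (k u)) hk (metric_sym (g v)); lra.
    exists w; have := metric_triangle (k u) (h v) (k' w).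
    by rewrite (metric_sym (k u) (h v)) hk hk' (metric_sym (g v)); lra.
  have [|v vw] := gf' w; first lra.
  have [|u uv] := gf v.
    by have := root_mdist_le k' h w v; rewrite (metric_sym (k' w)) hk'; lra.
  exists u; have := metric_triangle (k u) (h v) (k' w).
  by rewrite (metric_sym (k u) (h v)) hk hk' (metric_sym (g v)); lra.
have [[_ _ _ dt] _] := srm_metrizes S W.
apply: le_trans (dt (str_map h (mk_mark y)) _ _) _; apply: lerD.
  by rewrite Ssym (srm_coupling S _ _ hk) Ssym.
by rewrite (srm_coupling S _ _ hk').
Qed.

Lemma mclose_le e e' x y : e <= e' -> mclose e x y -> mclose e' x y.
Proof.
move=> ee' [e0 [e1|exy]]; split; try exact: lt_le_trans ee'.
  by left; exact: le_trans ee'.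
by right; exact: linked_le exy.
Qed.

Lemma mclose_sym e x y : mclose e x y -> mclose e y x.
Proof. by move=> [e0 [e1|/linked_sym]]; split=> //; [left|right]. Qed.

Lemma mclose_trans e e' x y z : mclose e x y -> mclose e' y z -> mclose (e + e') x z.
Proof.
move=> [e0 exy] [e'0 eyz]; split; first exact: addr_gt0.
have [|/ltW ee'1] := leP 1 (e + e'); first by left.
case: exy eyz => [e1|exy] [e'1|eyz]; [left; lra|left; lra|left; lra|right].
exact: linked_trans exy eyz.
Qed.

Lemma mclose_iso e x y : 0 < e -> marked_iso x y -> mclose e x y.
Proof.
move=> e0 [f [[_ _ fs] fa]]; split=> //; right.
exists (mk_space y), f, (@RIsoEmb R _ _ (isoemb_id (mk_space y)) erefl); split.
  have -> : range f = setT by apply/seteqP; split=> // z _; exact: fs.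
  have -> : range (@RIsoEmb R _ _ (isoemb_id (mk_space y)) erefl) = setT.
    by apply/seteqP; split=> // z _; exists z.
  exact: fclose_refl.
have [[d0 _ _ _] _] := srm_metrizes S (mk_space y).
by rewrite fa str_id d0 ltW.
Qed.

Lemma marked_iso_refl x : marked_iso x x.
Proof. exact/asboolP/marked_equiv_refl. Qed.

Let mclose_has_inf x y : has_inf [set e | mclose e x y].
Proof.
split; first by exists 1; split=> //; left.
by exists 0 => e [/ltW].
Qed.

Lemma mmdist_le e x y : mclose e x y -> mmdist x y <= e.
Proof. by move=> exy; apply: ge_inf => //; have [] := mclose_has_inf x y. Qed.

Lemma mmdist_lt e x y : mmdist x y < e -> mclose e x y.
Proof.
rewrite -subr_gt0 => xye; have [] := inf_adherent xye (mclose_has_inf x y).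
by move=> e' exy; rewrite addrC subrK => /ltW e'e; exact: mclose_le exy.
Qed.

Lemma mmdist_ge0 x y : 0 <= mmdist x y.
Proof.
by apply: lb_le_inf => [|e [/ltW]//]; have [] := mclose_has_inf x y.
Qed.

Lemma mmdist_iso x y : marked_iso x y -> mmdist x y = 0.
Proof.
move=> xy; apply/eqP; rewrite eq_le mmdist_ge0 andbT.
by apply/ler_addgt0Pr => e e0; rewrite add0r mmdist_le//; exact: mclose_iso.
Qed.

Lemma mmdist_sym x y : mmdist x y = mmdist y x.
Proof. by congr inf; apply/seteqP; split=> e /mclose_sym. Qed.

Lemma mmdist_triangle y x z : mmdist x z <= mmdist x y + mmdist y z.
Proof.
apply/ler_addgt0Pr => e e0; have e20 : 0 < e / 2 by rewrite divr_gt0.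
have xy : mclose (mmdist x y + e / 2) x y by apply: mmdist_lt; rewrite ltrDl.
have yz : mclose (mmdist y z + e / 2) y z by apply: mmdist_lt; rewrite ltrDl.
by apply: le_trans (mmdist_le (mclose_trans xy yz)) _; lra.
Qed.

Lemma mmdist_pseudo : pseudo_on setT mmdist.
Proof.
split=> *; [exact/mmdist_iso/marked_iso_refl|exact: mmdist_sym|exact: mmdist_triangle].
Qed.

Lemma mmdist_linked e x y : e <= 1 -> mmdist x y < e -> linked e x y.
Proof.
(* The midpoint is still below 1, which excludes the truncated alternative of [mclose]. *)
move=> e1 xye; have xy : mmdist x y < (mmdist x y + e) / 2 by lra.
have [e0 [|]] := mmdist_lt xy; first lra.
by apply: linked_le => //; lra.
Qed.

(** Turns smallness of [mmdist] at a fixed centre into convergence in the topology of a single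
    [tau W], where the metrization no longer matters. *)
Theorem linked_star x (y : nat -> marked tau) :
  (forall n, linked (2 ^- n.+1) x (y n)) ->
  exists (W : rbcm R) (h : risoemb (mk_space x) W)
      (k : forall n, risoemb (mk_space (y n)) W),
    (forall e, 0 < e -> exists N, forall n, (N <= n)%N ->
      fclose (range h) (range (k n)) e) /\
    str_map (k n) (mk_mark (y n)) @[n --> \oo] --> str_map h (mk_mark x).
Proof.
move=> /dependent_choice_ex[Z /dependent_choice_ex[f /dependent_choice_ex[g hg]]].
have fgN e : 0 < e -> exists N, forall n, (N <= n)%N -> fclose (range (f n)) (range (g n)) e.
  move=> /exp2N_small[N hN]; exists N => n Nn.
  apply: fclose_le (hN n.+1 (leqW Nn)) (hg n).1; exact: exp2N_gt0.
have [W [h [k hk]]] := star_glue fgN.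
exists W, h, k; split.
  move=> e /fgN[N hN]; exists N => n /hN /fcloseP[h1 h2].
  apply/fcloseP; split=> [u /h1[v uv]|v /h2[u uv]]; [exists v|exists u]; by rewrite hk.
apply/(metrizes_cvgP _ _ (srm_metrizes S W)) => e e0.
have e20 : 0 < e / 2 by rewrite divr_gt0.
have [N hN] := exp2N_small e20; exists N => n Nn.
rewrite (srm_coupling S _ _ (hk n)).
apply: le_lt_trans (hg n).2 _; apply: le_lt_trans (hN n.+1 (leqW Nn)) _; lra.
Qed.

End marked_metric.

(** * Independence of the metrization, open conditions, separation *)

Section marked_limits.
Context {R : realType} {tau : structure R}.
Implicit Types (S : srm tau) (x y : marked tau).

Lemma closed_range_limit (X W : bcm R) (h : isoemb X W) w :
  (forall e, 0 < e -> exists u, mdist w (h u) <= e) -> range h w.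
Proof.
move=> hw; apply: (closed_range_isoemb (f := h)) => B /nbhs_ballP[e /= e0 eB].
have [u wu] := hw (e / 2) ltac:(by rewrite divr_gt0).
exists (h u); split; first by exists u.
by apply: eB; rewrite ballEmdist /=; lra.
Qed.

(** A sequence of counterexamples glued around [x] has marks converging in [tau W], hence converging
    for [S'] as well. The argument fixes [x], so [e'] depends on it. *)
Lemma mmdist_indep S S' x e : 0 < e ->
  exists2 e', 0 < e' & forall y, mmdist S x y < e' -> mmdist S' x y < e.
Proof.
move=> e0; apply: contrapT => ne.
have /dependent_choice_ex[y hy] : forall n, exists y,
    mmdist S x y < 2 ^- n.+1 /\ ~ (mmdist S' x y < e).
  move=> n; apply: contrapT => ny; apply: ne; exists (2 ^- n.+1).
    exact: exp2N_gt0.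
  by move=> y xy; apply: contrapT => nxy; apply: ny; exists y.
have [|W [h [k [hk yx]]]] := @linked_star R tau S x y.
  move=> n; apply: mmdist_linked (hy n).1; exact: exp2N_le1.
have e20 : 0 < e / 2 by rewrite divr_gt0.
have [N hN] := hk _ e20.
have [M hM] := (metrizes_cvgP _ _ (srm_metrizes S' W)).2 yx _ e20.
apply: (hy (maxn N M)).2; apply: (@le_lt_trans _ _ (e / 2)); last first.
  by rewrite ltr_pdivrMr// mulr_natr mulr2n ltrDl.
apply: mmdist_le; split=> //; right; exists W, h, (k (maxn N M)); split.
  by apply: hN; exact: leq_maxl.
by apply: ltW; apply: hM; exact: leq_maxr.
Qed.

(** Pullback-stability moves membership from [x] to the glued space [W], openness there passes it to
    the marks of late [y n], and pullback-stability brings it back to [y n]. *)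
Lemma mmdist_open S (sub : forall X : rbcm R, set (tau X)) x :
  (forall X, open (sub X)) -> pullback_stable sub -> sub (mk_space x) (mk_mark x) ->
  exists2 e, 0 < e & forall y, mmdist S x y < e -> sub (mk_space y) (mk_mark y).
Proof.
move=> osub psub xsub; apply: contrapT => ne.
have /dependent_choice_ex[y hy] : forall n, exists y,
    mmdist S x y < 2 ^- n.+1 /\ ~ sub (mk_space y) (mk_mark y).
  move=> n; apply: contrapT => ny; apply: ne; exists (2 ^- n.+1).
    exact: exp2N_gt0.
  by move=> y xy; apply: contrapT => nxy; apply: ny; exists y.
have [|W [h [k [hk yx]]]] := @linked_star R tau S x y.
  move=> n; apply: mmdist_linked (hy n).1; exact: exp2N_le1.
have /yx[N _ hN] : nbhs (str_map h (mk_mark x)) (sub W).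
  by apply: open_nbhs_nbhs; split; [exact: osub|rewrite -(psub _ _ h) in xsub].
by apply: (hy N).2; rewrite -(psub _ _ (k N)); exact: (hN N (leqnn N)).
Qed.

(** Infinitely many copies of [y] are glued around [x]. Ascoli gives a limit embedding [goo] of [y]
    into [W]; by embedding-continuity it sends the mark of [y] to the image of the mark of [x]. As
    [goo] and [h] have the same range, the solution [q] of [h \o q = goo] is the isometry. *)
Lemma mmdist_eq0_iso S x y : embedding_continuous tau ->
  mmdist S x y = 0 -> marked_iso x y.
Proof.
move=> tauc xy0.
have [|W [h [k [hk yx]]]] := @linked_star R tau S x (fun=> y).
  move=> n; apply: mmdist_linked; first exact: exp2N_le1.
  by rewrite xy0 exp2N_gt0.
have [n_ [goo [n_mono gc gclose]]] := risoemb_ascoli k.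
have yg : str_map (k (n_ j)) (mk_mark y) @[j --> \oo] --> str_map goo (mk_mark y).
  exact: tauc gc _.
have yx' : str_map (k (n_ j)) (mk_mark y) @[j --> \oo] --> str_map h (mk_mark x).
  move=> B /yx[N _ hN]; exists N => // j /= Nj; apply: hN => /=.
  apply: leq_trans Nj _; elim: j => [//|j IH]; exact: leq_ltn_trans IH (n_mono _ _ (ltnSn j)).
have gh := metrizes_cvg_unique (srm_metrizes S W) yg yx'.
have n_ge j : (j <= n_ j)%N.
  by elim: j => [//|j IH]; exact: leq_ltn_trans IH (n_mono _ _ (ltnSn j)).
have near_g v e : 0 < e -> exists N, forall j, (N <= j)%N -> mdist (goo v) (k (n_ j) v) <= e.
  move=> e0; have [N hN] := exp2N_small (divr_gt0 e0 (ltr0n R 3)).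
  have [M hM] := exp2_large (mdist (root (mk_space y)) v).
  exists (maxn N M) => j; rewrite geq_max => /andP[Nj Mj].
  apply: le_trans (gclose j v (hM j Mj)) _; rewrite -ler_pdivlMr//; exact: hN.
have [|q qE] := @isoemb_factor R _ _ _ goo h.
  move=> _ [v _ <-]; apply: closed_range_limit => e e0.
  pose e' := Num.min (e / 2) (Num.max (mdist (root (mk_space y)) v) 1)^-1.
  have e'0 : 0 < e' by rewrite lt_min divr_gt0//= invr_gt0 lt_max ltr01 orbT.
  have [N hN] := hk e' e'0; have [M hM] := near_g v _ (divr_gt0 e0 (ltr0n R 2)).
  have := hN (n_ (maxn N M)) (leq_trans (leq_maxl N M) (n_ge _)).
  move=> /fcloseP[_ /(_ v)[]].
    apply: (@le_trans _ _ (Num.max (mdist (root (mk_space y)) v) 1)).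
      by rewrite le_max lexx.
    by rewrite -[leLHS]invrK lef_pV2 ?posrE ?invr_gt0 ?lt_max ?ltr01 ?orbT// ge_min lexx orbT.
  move=> u uv; exists u; have ue : e' <= e / 2 by rewrite ge_min lexx.
  have := metric_triangle (goo v) (k (n_ (maxn N M)) v) (h u).
  rewrite (metric_sym (k _ _)); have := hM _ (leq_maxr N M).
  move: uv ue => /le_trans h1 /h1; set d1 := mdist _ _; set d2 := mdist _ _.
  lra.
have qm : str_map q (mk_mark y) = mk_mark x.
  have [hinj _ _] := str_embedding tau h.
  by apply: hinj; rewrite -gh -(str_map_comp_eq _ qE).
have qs u : range q u.
  have [v _ vu] : range goo (h u).
    apply: closed_range_limit => e e0.
    pose r := mdist (root (mk_space x)) u + 1.
    have r0 : 0 < r by rewrite ltr_wpDl// mdist_ge0.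
    pose e' := Num.min (Num.min (e / 2) 1) r^-1.
    have e'0 : 0 < e' by rewrite !lt_min divr_gt0//= ltr01 invr_gt0.
    have [N hN] := hk e' e'0.
    (* The rate in [risoemb_ascoli] is [2 ^- j * 3], so [e / 6] makes that contribution [e / 2]. The
       1 in [e'] keeps the norm of the partner [v] of [u] below [r]. *)
    have [N' hN'] := exp2N_small (divr_gt0 e0 (ltr0n R 6)).
    have [M hM] := exp2_large r.
    pose j := maxn N (maxn N' M).
    have := hN (n_ j) (leq_trans (leq_maxl _ _) (n_ge _)).
    move=> /fcloseP[/(_ u)[] ].
      apply: (@le_trans _ _ r); first by rewrite lerDl.
      by rewrite -[leLHS]invrK lef_pV2 ?posrE ?invr_gt0// ge_min lexx orbT.
    move=> v; rewrite !le_min -andbA => /and3P[uv1 uv2 _] _; exists v.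
    have vr : mdist (root (mk_space y)) v <= 2 ^+ j.
      apply: le_trans (hM j _); last by rewrite !leq_max leqnn !orbT.
      by apply: le_trans (root_mdist_le h (k (n_ j)) u v) _; rewrite lerD2l.
    have j6 : 2 ^- j <= e / 6 by apply: hN'; rewrite !leq_max leqnn !orbT.
    have := gclose j v vr; rewrite metric_sym.
    have := metric_triangle (h u) (k (n_ j) v) (goo v).
    move: uv1 j6; clear; set d1 := mdist _ _; set d2 := mdist _ _; set d3 := mdist _ _.
    lra.
  by exists v => //; apply: (@isoemb_inj _ _ _ h); rewrite qE.
have yx_iso : marked_iso y x by exists q; split=> //; split=> // u v _ _; exact: isoemb_inj.
apply/asboolP; have := @marked_equiv_sym R tau x y; rewrite /marked_equiv => ->.
exact/asboolP.
Qed.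

End marked_limits.

(** * Completeness *)

Section limit_set.
Context {R : realType} (X : nat -> rbcm R) (W : rbcm R) (h : forall n, risoemb (X n) W).

Definition limit_set : set W := [set w | forall e, 0 < e ->
  exists N, forall n, (N <= n)%N -> exists x, mdist w (h n x) <= e].

Lemma closed_limit_set : closed limit_set.
Proof.
move=> w cw e e0; have e20 : 0 < e / 2 by rewrite divr_gt0.
have [w' [w'L ww']] := cw _ (nbhsx_ballx w _ e20).
have [N hN] := w'L _ e20; exists N => n /hN[x w'x]; exists x.
by move: ww'; rewrite ballEmdist /=; have := metric_triangle w w' (h n x); lra.
Qed.

Lemma limit_set_root : limit_set (root W).
Proof.
move=> e e0; exists 0%N => n _; exists (root (X n)).
by rewrite risoemb_root mdistxx ltW.
Qed.

Hypothesis up : forall N n (x : X N), (N <= n)%N -> mdist (root (X N)) x <= 2 ^+ N - 2 ->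
  exists x' : X n, mdist (h N x) (h n x') <= 2 * 2 ^- N.
Hypothesis down : forall N n (x : X n), (N <= n)%N -> mdist (root (X n)) x <= 2 ^+ N - 2 ->
  exists x' : X N, mdist (h N x') (h n x) <= 2 * 2 ^- N.

Let norm_le n (x : X n) w : mdist (root (X n)) x <= mdist (root W) w + mdist w (h n x).
Proof. by rewrite -(isoemb_mdist (h n)) risoemb_root; exact: metric_triangle. Qed.

(** The successors of [x] in later pieces cluster at some [w], a priori only along a subsequence;
    [down] brings them back to any given index, so [w] is approached by every late piece. *)
Lemma limit_set_up N (x : X N) : mdist (root (X N)) x <= 2 ^+ N - 2 ->
  exists2 w, limit_set w & mdist (h N x) w <= 2 * 2 ^- N.
Proof.
move=> xN; pose K := cball (h N x) (2 * 2 ^- N).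
have /dependent_choice_ex[c hc] : forall n, exists w, (N <= n)%N ->
    K w /\ range (h n) w.
  move=> n; have [Nn|_] := leqP N n; last by exists (root W).
  by have [x' xx'] := up Nn xN; exists (h n x') => _; split=> //; exists x'.
have KF : (c @ \oo) K by exists N => // n /= /hc[].
have [w [Kw wc]] := bcm_compact (fmap_proper_filter c _) KF.
exists w => // e e0; have e40 : 0 < e / 4 by rewrite divr_gt0.
(* The 3 is the 2 of the radius in [down] plus a displacement of at most 1 from [w]. *)
have [M1 hM1] := exp2N_small e40; have [M2 hM2] := exp2_large (mdist (root W) w + 3).
exists (maxn M1 M2) => n; rewrite geq_max => /andP[M1n M2n].
have d0 : 0 < Num.min (e / 2) 1 by rewrite lt_min ltr01 andbT divr_gt0.
have cF : (c @ \oo) (c @` [set j | (maxn n N <= j)%N]).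
  by exists (maxn n N) => // j /= nj; exists j.
have [_ [[j /= nNj <-]]] := wc _ _ cF (nbhsx_ballx w _ d0).
move: nNj; rewrite geq_max => /andP[nj Nj].
have [_ [y _ <-]] := hc j Nj.
rewrite ballEmdist /= lt_min => /andP[wy1 wy2].
have [|x' x'y] := down nj (x := y).
  by have := norm_le y w; have := hM2 n M2n; move: wy2; lra.
exists x'; have := metric_triangle w (h j y) (h n x'); have := hM1 n M1n.
by rewrite (metric_sym (h j y)); move: wy1 x'y; lra.
Qed.

Lemma limit_set_down n w : limit_set w -> mdist (root W) w <= 2 ^+ n - 3 ->
  exists x, mdist w (h n x) <= 3 * 2 ^- n.
Proof.
move=> wL wn; have [N hN] := wL _ (exp2N_gt0 n).
have [y wy] := hN (maxn N n) (leq_maxl _ _).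
have [|x xy] := down (leq_maxr N n) (x := y).
  by have := norm_le y w; have := exp2N_le1 (R := R) n; lra.
exists x; have := metric_triangle w (h (maxn N n) y) (h n x).
by rewrite (metric_sym (h _ y)); lra.
Qed.

Lemma limit_set_fclose e : 0 < e -> exists N, forall n, (N <= n)%N ->
  fclose limit_set (range (h n)) e.
Proof.
move=> e0; have [N1 hN1] := exp2N_small (divr_gt0 e0 (ltr0n R 3)).
have [N2 hN2] := exp2_large (e^-1 + 3).
exists (maxn N1 N2) => n; rewrite geq_max => /andP[/hN1 ne /hN2 er].
split=> [w [wL]|_ [[x _ <-]]]; rewrite /cball /=.
  move=> wr; have [|x wx] := limit_set_down (n := n) wL; first lra.
  by exists (h n x); [exists x|lra].
rewrite -(risoemb_root (h n)) isoemb_mdist => xr.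
have [|w wL xw] := @limit_set_up n x; first lra.
by exists w => //; have := exp2N_gt0 (R := R) n; lra.
Qed.

End limit_set.

Section marked_completeness.
Context {R : realType} {tau : structure R} (S : srm tau).
Hypotheses (Sc : complete_srm S) (tauu : upper_semicontinuous tau).

Theorem linked_chain (u : nat -> marked tau) :
  (forall n, linked S (2 ^- n) (u n) (u n.+1)) ->
  exists l, forall e, 0 < e -> exists N, forall n, (N <= n)%N -> mmdist S (u n) l <= e.
Proof.
move=> /dependent_choice_ex[Z /dependent_choice_ex[f /dependent_choice_ex[g fg]]].
have [|W [h [hE up down]]] := @chain_glue R (fun n => mk_space (u n)) Z f g.
  by move=> n; case: (fg n).
pose a n := str_map (h n) (mk_mark (u n)).
have aS n : srm_dist S W (a n) (a n.+1) <= 2 ^- n.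
  by rewrite (srm_coupling S _ _ (hE n)); case: (fg n).
have [[d0 dpos ds dt] _] := srm_metrizes S W.
have ak n k : srm_dist S W (a n) (a (k + n)%N) <= 2 * 2 ^- n - 2 * 2 ^- (k + n).
  elim: k => [|k IH]; first by rewrite d0 subrr.
  apply: le_trans (dt (a (k + n)%N) _ _) _; rewrite addSn.
  by have := aS (k + n)%N; have := exp2NS (R := R) (k + n); lra.
have an n m : (n <= m)%N -> srm_dist S W (a n) (a m) <= 2 * 2 ^- n.
  move=> nm; have := ak n (m - n)%N; rewrite subnK//.
  by have := exp2N_gt0 (R := R) m; lra.
have [|l al] := Sc (u := a).
  move=> e e0; have [N hN] := exp2N_small (divr_gt0 e0 (ltr0n R 5)).
  exists N => m n Nm Nn; apply: le_lt_trans (dt (a N) _ _) _; rewrite ds.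
  by have := an _ _ Nm; have := an _ _ Nn; have := hN N (leqnn N); lra.
have {}al e : 0 < e -> exists N, forall n, (N <= n)%N -> srm_dist S W l (a n) < e.
  move=> e0; have /cvgrPdist_lt/(_ _ e0)[N _ hN] := al; exists N => n /hN.
  by rewrite sub0r normrN ds ger0_norm// (pseudo_on_ge0 (metrizes_pseudo (srm_metrizes S W))).
have la : a n @[n --> \oo] --> l by apply/(metrizes_cvgP _ _ (srm_metrizes S W)).
have [V [i iL]] := subbcm (closed_limit_set (h := h)) (limit_set_root h).
have Lc e (e0 : 0 < e) : exists N, forall n, (N <= n)%N -> fclose (range i) (range (h n)) e.
  by rewrite iL; exact: (limit_set_fclose up down).
have [b _ bl] := tauu (fclose_cvg_fell Lc) la.
exists (Marked b) => e e0; have [N hN] := Lc e e0; have [M hM] := al e e0.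
exists (maxn N M) => n; rewrite geq_max => /andP[/hN Vn /hM ln].
apply: mmdist_le; split=> //; right; exists W, (h n), i.
by split; [exact: fclose_sym|rewrite /= bl ds ltW].
Qed.

Theorem mmdist_complete : complete_dist (mmdist S).
Proof.
move=> u uc.
have [|n_ [n_mono n_close]] := @subseq_exists (fun k n =>
    forall m, (n <= m)%N -> mmdist S (u n) (u m) < 2 ^- k).
  move=> k N; have [M hM] := uc _ (exp2N_gt0 k).
  exists (maxn N M); first exact: leq_maxl.
  move=> m nm; apply: hM; first exact: leq_maxr.
  by apply: leq_trans nm; exact: leq_maxr.
have [|l hl] := @linked_chain (u \o n_).
  move=> k; apply: mmdist_linked; first exact: exp2N_le1.
  by apply: n_close; exact/ltnW/n_mono.
exists l; apply/cvgrPdist_le => e e0; have e20 : 0 < e / 2 by rewrite divr_gt0.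
have [N hN] := hl _ e20; have [M hM] := exp2N_small e20.
pose k := maxn N M; exists (n_ k) => // n /= kn.
rewrite sub0r normrN ger0_norm ?mmdist_ge0//.
have := mmdist_triangle S (u (n_ k)) (u n) l; rewrite (mmdist_sym _ (u n) (u _)).
have := n_close k n kn; have := hN k (leq_maxl _ _); have := hM k (leq_maxr _ _).
rewrite /=; lra.
Qed.

End marked_completeness.

(** * Separability *)

Section finite_spaces.
Context {R : realType}.

(* The carrier of a finite space has to live in a small universe: 'I_n does not
   fit in mspace, the sort predArgType being above the sort of ms_carrier. *)
Definition fin n : Type := {i : nat | (i < n.+1)%N}.
Definition fin0 n : fin n := exist _ 0%N (ltn0Sn n).

Lemma fin_val_lt n (i : fin n) : (val i < n.+1)%N.
Proof. exact: valP i. Qed.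

Section fin_rbcm.
Variables (n : nat) (d : fin n -> fin n -> R) (dm : is_metric d).

Lemma fin_compact (x : MSpace dm) r : compact (cball x r).
Proof.
apply: finite_compact.
have -> : cball x r = (fun i : 'I_n.+1 => insubd (fin0 n) (val i)) @`
    [set i | cball x r (insubd (fin0 n) (val i))].
  apply/seteqP; split=> [y xy|_ [i xi <-]//].
  exists (Ordinal (fin_val_lt y)); rewrite /= valKd//.
by apply: finite_image; exact: finite_finset.
Qed.

Definition fin_rbcm : rbcm R :=
  @Rbcm R (@Bcm R (MSpace dm) (inhabits (fin0 n)) fin_compact) (fin0 n).

End fin_rbcm.

Section fin_coupling.
Variables (X : rbcm R) (n : nat) (d : fin n -> fin n -> R) (dm : is_metric d).
Variables (xs : fin n -> X).
Let dX : X -> X -> R := @ms_dist R X.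
Let dXX x : dX x x = 0. Proof. exact: mdistxx. Qed.
Let dXs x y : dX x y = dX y x. Proof. exact: metric_sym. Qed.
Let dXt y x z : dX x z <= dX x y + dX y z. Proof. exact: metric_triangle. Qed.

Hypothesis xs0 : xs (fin0 n) = root X.
(** Two excesses of at least [eta] outweigh one of at most [2 * eta]: rounded distances of this kind
    satisfy the triangle inequality on distinct indices. The lower bound also separates indices
    whose points [xs i] coincide. *)
Definition dist_excess eta : Prop := 0 < eta /\ forall i j : fin n, i != j ->
  dX (xs i) (xs j) + eta <= d i j <= dX (xs i) (xs j) + 2 * eta.

(** Index [j] hangs at height [c j] above [xs j]. A constant positive height would separate the
    roots; the excess seen from index 0 vanishes there and lies between [eta] and [2 * eta]
    elsewhere. *)
Let c j : R := d (fin0 n) j - dX (root X) (xs j).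

Definition fin_glue (s t : X + fin n) : R :=
  match s, t with
  | inl x, inl y => dX x y
  | inl x, inr j | inr j, inl x => dX x (xs j) + c j
  | inr i, inr j => d i j
  end.

Let c0 : c (fin0 n) = 0.
Proof. by rewrite /c -xs0 dXX; case: dm => ->; rewrite subrr. Qed.

Let c_excess eta : dist_excess eta -> [/\ forall j, 0 <= c j, forall j, c j <= 2 * eta,
  forall j k, dX (xs j) (xs k) + c j <= c k + d j k &
  forall j k, d j k <= dX (xs j) (xs k) + c j + c k].
Proof.
move=> [eta0 dh]; have [d0 _ ds _] := dm.
have c_ge j : j != fin0 n -> eta <= c j /\ c j <= 2 * eta.
  rewrite eq_sym /c -xs0 => /dh/andP[h1 h2].
  by split; lra.
have c0h j : 0 <= c j /\ c j <= 2 * eta.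
  have [->|/c_ge[h1 h2]] := eqVneq j (fin0 n); first by rewrite c0; split; lra.
  by split; lra.
split=> [j|j|j k|j k]; [by case: (c0h j)|by case: (c0h j)|..].
  have [->|jk] := eqVneq j k; first by rewrite dXX d0; lra.
  have [->|/c_ge[h1 h2]] := eqVneq k (fin0 n).
    by rewrite xs0 c0 /c (dXs (xs j)) (ds j); lra.
  by have [h3 h4] := c0h j; have /andP[] := dh j k jk; lra.
have [->|jk] := eqVneq j k; first by rewrite dXX d0; have [h1 h2] := c0h k; lra.
have [->|/c_ge[h1 h2]] := eqVneq k (fin0 n).
  by rewrite xs0 c0 /c (dXs (xs j)) (ds j); lra.
have [->|/c_ge[h3 h4]] := eqVneq j (fin0 n); first by rewrite xs0 c0 /c; lra.
by have /andP[] := dh j k jk; lra.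
Qed.

Let fin_glue_pseudo eta : dist_excess eta -> pseudo_on setT fin_glue.
Proof.
move=> /c_excess[c_ge0 c_le c_lip d_c]; have [d0 _ ds dt] := dm.
split.
- by move=> [x|i] _ /=; [exact: dXX|exact: d0].
- by move=> [x|i] [y|j] _ _ //=.
- move=> [y|j] [x|i] [z|k] _ _ _ /=.
  + exact: dXt.
  + by have := dXt y x (xs k); lra.
  + by have := dXt z y (xs i); have := dXt y z (xs i); rewrite (dXs z y); lra.
  + have := d_c i k; have := dXt y (xs i) (xs k).
    by rewrite (dXs (xs i) y); lra.
  + have := dXt (xs j) x z; rewrite (dXs (xs j) z).
    by have := c_ge0 j; lra.
  + have := dXt (xs j) x (xs k); have := c_lip k j.
    by rewrite (ds k j) (dXs (xs k)); lra.
  + have := dXt (xs j) z (xs i); have := c_lip i j.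
    by rewrite (dXs (xs i)); lra.
  + exact: dt.
Qed.

Lemma fin_coupling_exists eta : dist_excess eta ->
  exists (Z : rbcm R) (f : risoemb X Z) (g : risoemb (fin_rbcm dm) Z),
  forall x j, mdist (f x) (g j) <= mdist x (xs j) + 2 * eta.
Proof.
move=> h_eta; have [_ c_le _ _] := c_excess h_eta.
have gp := fin_glue_pseudo h_eta; have [p0 ps pt] := gp.
have [|Z [h [hE hr]]] := @pseudo_completion R _ fin_glue (inl (root X)) gp.
  move=> r e e0; pose A := [set t | fin_glue (inl (root X)) t <= r].
  have netX := has_net_image (p := @mdist R X) (q := fin_glue) (h := inl)
    (fun _ _ => erefl) (bcm_has_net (root X) r e0).
  have netF : has_net fin_glue (range inr) e.
    exists n.+1, (fun k => inr (insubd (fin0 n) k)) => _ [j _ <-]; exists (val j).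
      exact: fin_val_lt.
    by rewrite valKd p0// ltW.
  apply: sub_has_net (has_netU netX netF) => -[x|j] /= xr; last by right; exists j.
  by left; exists x.
have fd x y : mdist (h (inl x)) (h (inl y)) = mdist x y by rewrite hE.
have gd (i j : fin_rbcm dm) : mdist (h (inr i)) (h (inr j)) = mdist i j by rewrite hE.
have gr : IsoEmb gd (root (fin_rbcm dm)) = root Z.
  by rewrite -hr; apply: mdist_positivity; rewrite /= hE /= c0 addr0 xs0; exact: mdistxx.
exists Z, (@RIsoEmb R X Z (IsoEmb fd) hr), (RIsoEmb gr) => x j /=.
by rewrite hE /= lerD2l c_le.
Qed.

End fin_coupling.

(** Finite functions on ordinals with values in [nat] form a [countType], so the approximating
    spaces are countable in number. *)
Definition grid_dist n (m : {ffun 'I_n.+1 * 'I_n.+1 -> nat}) (N : nat)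
  (i j : fin n) : R := (m (inord (val i), inord (val j)))%:R / N.+1%:R.

Lemma grid_approx (X : rbcm R) N :
  exists n (m : {ffun 'I_n.+1 * 'I_n.+1 -> nat}) (dm : is_metric (grid_dist m N))
    (Z : rbcm R) (f : risoemb X Z) (g : risoemb (fin_rbcm dm) Z),
  fclose (range f) (range g) (3 / N.+1%:R).
Proof.
pose eta : R := N.+1%:R^-1; have eta0 : 0 < eta by rewrite invr_gt0.
have [n [G hG]] := bcm_has_net (root X) (eta^-1) eta0.
(* Index 0 is kept for the root, so net point [k] has index [k.+1]. *)
pose xs (i : fin n) := if i == fin0 n then root X else G (val i).-1.
(* The integer part plus 2, divided by [N.+1], exceeds the distance by more than [eta] and by at
   most [2 * eta]. *)
pose m0 (i j : fin n) := if i == j then 0%N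
  else (Num.truncn (N.+1%:R * mdist (xs i) (xs j))).+2.
pose m := [ffun ij : 'I_n.+1 * 'I_n.+1 =>
  m0 (insubd (fin0 n) (val ij.1)) (insubd (fin0 n) (val ij.2))].
have mE (i j : fin n) : grid_dist m N i j = (m0 i j)%:R / N.+1%:R.
  by rewrite /grid_dist ffunE /= !inordK ?fin_val_lt// !valKd.
have md (i j : fin n) : i != j -> mdist (xs i) (xs j) + eta <= grid_dist m N i j <=
    mdist (xs i) (xs j) + 2 * eta.
  move=> ij; rewrite mE /m0 (negbTE ij); set D := mdist _ _.
  have D0 : 0 <= N.+1%:R * D by rewrite mulr_ge0// mdist_ge0.
  have /andP[h1 h2] := truncn_itv D0.
  rewrite ler_pdivlMr// ler_pdivrMr// !mulrDl -mulrA /eta mulVf// mulr1 (mulrC D).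
  by rewrite -[X in _ <= X%:R <= _]addn2 natrD; move: h1 h2; rewrite -natr1; lra.
have dm : is_metric (grid_dist m N).
  have d0 i : grid_dist m N i i = 0 by rewrite mE /m0 eqxx mul0r.
  split=> // [i j|i j|j i k].
  - have [//|ij] := eqVneq i j; have /andP[h _] := md i j ij.
    have mg : 0 <= mdist (xs i) (xs j) by exact: mdist_ge0.
    by move=> g0; rewrite g0 in h; exfalso; lra.
  - by rewrite !mE /m0 eq_sym metric_sym.
  - have g0 u v : 0 <= grid_dist m N u v by rewrite divr_ge0.
    have [<-|ij] := eqVneq i j; first by rewrite d0 add0r.
    have [<-|jk] := eqVneq j k; first by rewrite d0 addr0.
    have [<-|ik] := eqVneq i k; first by rewrite d0 addr_ge0.
    have /andP[? ?] := md i j ij; have /andP[? ?] := md j k jk; have /andP[? ?] := md i k ik.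
    by have := metric_triangle (xs i) (xs j) (xs k); lra.
exists n, m, dm.
have xs0 : xs (fin0 n) = root X by rewrite /xs eqxx.
have [Z [f [g fg]]] := @fin_coupling_exists X n _ dm xs xs0 eta (conj eta0 md).
exists Z, f, g; apply/fcloseP; rewrite -/eta; split=> [x xr|j _].
  have [|k kn Gx] := hG x.
    rewrite /cball /=; apply: le_trans xr _; rewrite invfM ler_piMl ?invr_ge0 ?ltW//.
    by rewrite invf_lt1; lra.
  exists (insubd (fin0 n) k.+1); apply: le_trans (fg _ _) _.
  have -> : xs (insubd (fin0 n) k.+1) = G k.
    by rewrite /xs -val_eqE /= val_insubd ltnS kn.
  by rewrite metric_sym; lra.
exists (xs j); apply: le_trans (fg _ _) _; rewrite mdistxx; lra.
Qed.

End finite_spaces.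

Section marked_separability.
Context {R : realType} {tau : structure R} (S : srm tau).

Lemma dense_srm (X : rbcm R) (D : set (tau X)) (a : tau X) e :
  dense D -> 0 < e -> exists2 b, D b & srm_dist S X a b < e.
Proof.
move=> dD e0; have [[d0 _ _ _] _] := srm_metrizes S X.
have := metrizes_ball a (srm_metrizes S X) e0; rewrite nbhsE => -[V [oV Va] Ve].
have [||b [Vb Db]] := dD V; [by exists a|exact: oV|].
by exists b => //; exact: Ve.
Qed.

Let code : countType := ({n : nat & {ffun 'I_n.+1 * 'I_n.+1 -> nat}} * nat)%type.
Let code_dist (c : code) := @grid_dist R _ (tagged c.1) c.2.

(** Finite spaces approximating [x] are glued around it; lower semicontinuity supplies marks on them
    converging to the mark of [x], and each such mark is then replaced by one in the chosen dense
    set. *)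
Theorem mmdist_separable : lower_semicontinuous tau ->
  (forall X : bcm R, separable (tau X)) ->
  exists2 C : set (marked tau), countable C &
    forall x e, 0 < e -> exists2 y, C y & mmdist S x y < e.
Proof.
move=> taul hsep.
have /dependent_choice_ex[D hD] : forall X : bcm R, exists D : set (tau X), countable D /\ dense D.
  by move=> X; have [D] := hsep X; exists D.
pose C (c : code) : set (marked tau) :=
  [set y | exists (h : is_metric (@code_dist c)) (a : tau (fin_rbcm h)),
    D (fin_rbcm h) a /\ y = Marked a].
exists (\bigcup_c C c).
  apply: bigcup_countable => [|c _]; first exact: countableP.
  have [h|nh] := pselect (is_metric (@code_dist c)).
    apply: (@sub_countable _ _ _ ((fun a => Marked (mk_space := fin_rbcm h) a) @` D (fin_rbcm h))).
      apply: subset_card_le => _ [h' [a [Da ->]]].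
      (* All proofs of metricity for one code are equal, so a code determines a single space and
         contributes only the marks of one countable set. *)
      by rewrite (Prop_irrelevance h' h) in a Da *; exists a.
    exact: sub_countable (card_image_le _ _) (hD (fin_rbcm h)).1.
  by apply: (sub_countable (B := set0)) => //; apply: subset_card_le => y [h _]; exact: nh.
move=> x e e0.
have /dependent_choice_ex[n /dependent_choice_ex[m /dependent_choice_ex[dm
  /dependent_choice_ex[Z /dependent_choice_ex[f /dependent_choice_ex[g fg]]]]]] :=
  grid_approx (mk_space x).
have fgN e' : 0 < e' -> exists N, forall j, (N <= j)%N ->
    fclose (range (f j)) (range (g j)) e'.
  move=> e'0.
  have [N _ hN] : \forall j \near \oo, j.+1%:R^-1 <= e' / 3 :> R.
    have /cvgrPdist_le/(_ _ (divr_gt0 e'0 (ltr0n R 3))) := @cvg_harmonic R.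
    by apply: filterS => j; rewrite sub0r normrN ger0_norm// invr_ge0.
  exists N => j /hN; rewrite /= ler_pdivlMr// mulrC => je.
  by apply: fclose_le je (fg j); rewrite divr_gt0.
have [W [h [k hk]]] := star_glue fgN.
have hkN e' : 0 < e' -> exists N, forall j, (N <= j)%N -> fclose (range h) (range (k j)) e'.
  move=> /fgN[N hN]; exists N => j /hN /fcloseP[h1 h2].
  apply/fcloseP; split=> [u /h1[v uv]|v /h2[u uv]]; [exists v|exists u]; by rewrite hk.
have [n_ [b [n_mono bx]]] := taul _ _ _ _ _ (fclose_cvg_fell hkN) (mk_mark x).
have e20 : 0 < e / 2 by rewrite divr_gt0.
have e40 : 0 < e / 4 by rewrite divr_gt0.
have [N hN] := hkN _ e20.
have [M hM] := (metrizes_cvgP _ _ (srm_metrizes S W)).2 bx _ e40.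
pose j := maxn N M.
have n_ge i : (i <= n_ i)%N.
  by elim: i => [//|i IH]; exact: leq_ltn_trans IH (n_mono _ _ (ltnSn i)).
have [a Da ba] := dense_srm (b j) (hD (fin_rbcm (dm (n_ j)))).2 e40.
exists (Marked (mk_space := fin_rbcm (dm (n_ j))) a).
  by exists (existT _ (n (n_ j)) (m (n_ j)), n_ j) => //; exists (dm (n_ j)), a.
apply: (@le_lt_trans _ _ (e / 2)); last by rewrite ltr_pdivrMr// mulr_natr mulr2n ltrDl.
apply: mmdist_le; split=> //; right; exists W, h, (k (n_ j)); split.
  by apply: hN; apply: leq_trans (n_ge _); exact: leq_maxl.
have [[_ _ _ dt] _] := srm_metrizes S W.
apply: le_trans (dt (str_map (k (n_ j)) (b j)) _ _) _.
rewrite srm_isometric; have -> : e / 2 = e / 4 + e / 4 by lra.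
by apply: lerD; apply: ltW; [apply: hM; exact: leq_maxr|exact: ba].
Qed.

End marked_separability.

(** * Comparison with the integrated Fell distance *)

Section fell_dist_facts.
Context {R : realType}.

(* The integral of a nonnegative function is a supremum over simple functions,
   so that monotonicity needs no measurability; the integrand of fell_dist is
   never shown to be measurable. *)
Lemma ge0_le_integral_nomeas d (T : measurableType d) (mu : {measure set T -> \bar R})
    (D : set T) (f1 f2 : T -> \bar R) :
  (forall x, D x -> (0 <= f1 x)%E) -> (forall x, D x -> (f1 x <= f2 x)%E) ->
  (\int[mu]_(x in D) f1 x <= \int[mu]_(x in D) f2 x)%E.
Proof.
move=> f10 f12; rewrite !ge0_integralE//; last first.
  by move=> x Dx; apply: le_trans (f12 x Dx); exact: f10.
apply: ereal_sup_le => _ [h hf <-]; exists h => // x.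
apply: le_trans (hf x) _; rewrite /patch; case: ifPn => // /set_mem; exact: f12.
Qed.

Lemma hausdorff_dist_ge0 (M : metricType R) (A B : set M) : (0 <= hausdorff_dist A B)%E.
Proof. by apply: le_ereal_inf_tmp => _ [e [e0 _ _] <-]; rewrite lee_fin. Qed.

Let integrand (M : rbcm R) (A B : set M) (r : R) : \bar R :=
  ((expR (- r))%:E * mine 1 (hausdorff_dist (A `&` cball (root M) r) (B `&` cball (root M) r)))%E.

Let integrand_ge0 (M : rbcm R) (A B : set M) r : (0 <= integrand A B r)%E.
Proof.
apply: mule_ge0; first by rewrite lee_fin expR_ge0.
by rewrite le_min hausdorff_dist_ge0 andbT.
Qed.

(** A point of [A] in the ball of radius [e^-1] with no point of [B] within [e] forces a Hausdorff
    distance of at least [e] for all [r] in [[e^-1, e^-1 + 1]]. The constant bounds the integrand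
    from below on this interval of length 1. *)
Lemma fell_dist_half (M : rbcm R) (A B : set M) e : 0 < e ->
  (fell_dist A B < (expR (- (e^-1 + 1)) * Num.min 1 e)%:E)%E ->
  A `&` cball (root M) e^-1 `<=` thickening B e.
Proof.
move=> e0 + x [Ax xe]; apply: contraPP => nx; apply/negP; rewrite -leNgt.
set c := expR _ * _; have c0 : 0 <= c by rewrite mulr_ge0 ?expR_ge0// le_min ler01 ltW.
have e10 : 0 <= e^-1 by rewrite invr_ge0 ltW.
pose I : set R := `[e^-1, e^-1 + 1]%classic.
have mI : measurable I by exact: measurable_itv.
have mIE : lebesgue_measure I = 1%E.
  by rewrite /I lebesgue_measure_itv /= lte_fin ltrDl ltr01 -EFinB addrAC subrr add0r.
have IE : (\int[lebesgue_measure]_(r in `[0%R, +oo[%classic) (c%:E * (\1_I r)%:E) = c%:E)%E.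
  rewrite ge0_integralZl//; first last.
    by apply/measurable_EFinP; exact: measurable_indic.
  rewrite integral_indic//.
  have -> : I `&` `[0%R, +oo[%classic = I.
    by apply/setIidPl => r; rewrite /I /= !in_itv /= andbT => /andP[/(le_trans e10)].
  by rewrite [X in (_ * X)%E]mIE mule1.
rewrite -IE; apply: ge0_le_integral_nomeas => [r _|r].
  by rewrite -EFinM lee_fin mulr_ge0.
rewrite /= in_itv /= andbT => r0; rewrite indicE.
case: (boolP (r \in I)) => [|_]; last by rewrite mule0; exact: integrand_ge0.
rewrite inE /I /= in_itv /= mule1 => /andP[er re1].
rewrite /c EFinM; apply: lee_pmul.
- by rewrite lee_fin expR_ge0.
- by rewrite lee_fin le_min ler01 ltW.
- by rewrite lee_fin ler_expR lerN2.
- rewrite le_min; apply/andP; split; first by rewrite lee_fin ge_min lexx.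
  apply: le_ereal_inf_tmp => _ [e' [e'0 + _] <-] => /(_ x)[].
    by split=> //; exact: le_trans er.
  move=> y [By _] xy; rewrite lee_fin ge_min; apply/orP; right.
  rewrite leNgt; apply/negP => e'e; apply: nx; exists y => //.
  by apply: le_trans xy _; exact: ltW.
Qed.

Lemma fell_dist_sym (M : rbcm R) (A B : set M) : fell_dist A B = fell_dist B A.
Proof.
apply: eq_integral => r _; congr (_ * mine _ _)%E.
by congr ereal_inf; apply/seteqP; split=> _ [e [e0 ? ?] <-]; exists e.
Qed.

Lemma fell_dist_fclose (M : rbcm R) (A B : set M) e : 0 < e ->
  (fell_dist A B < (expR (- (e^-1 + 1)) * Num.min 1 e)%:E)%E -> fclose A B e.
Proof.
move=> e0 AB; split; first exact: fell_dist_half.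
by apply: fell_dist_half => //; rewrite fell_dist_sym.
Qed.

(* A radius s can only be bad for X when it is within eps of the distance from
   the root to one of the finitely many cells of a net. *)
Lemma hausdorff_good_radius (X : rbcm R) (s0 delta : R) : 0 < delta ->
  exists (N : nat) (m : nat -> R), forall eps, 0 < eps -> eps <= delta ->
    eps <= 1 -> s0 <= eps^-1 ->
    forall (Y Z : rbcm R) (f : risoemb X Z) (g : risoemb Y Z),
    fclose (range f) (range g) eps ->
    forall s, 0 <= s -> s <= s0 ->
    (forall j, (j < N)%N -> ~ (m j - eps <= s <= m j + eps)) ->
    (hausdorff_dist (range f `&` cball (root Z) s) (range g `&` cball (root Z) s)
      <= (2 * delta)%:E)%E.
Proof.
move=> d0; have d20 : 0 < delta / 2 by rewrite divr_gt0.
have [N [F hF]] := bcm_has_net (root X) (s0 + 1) d20.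
pose cell j := [set mdist (root X) x | x in [set x | mdist (F j) x <= delta / 2]].
have cell_inf j : has_inf (cell j).
  split; first by exists (mdist (root X) (F j)), (F j) => //=; rewrite mdistxx ltW.
  by exists 0 => _ [x _ <-]; exact: mdist_ge0.
exists N, (fun j => inf (cell j)) => eps eps0 eps_d eps1 s0e Y Z f g /fcloseP[fg gf] s s_ge0 ss0 good.
(* At a good radius the infimum of the cell of [x] lies below [s - eps], so [x] can be traded for a
   point of that cell well inside the ball, whose partner then lies in the ball too. *)
have shrink x : mdist (root X) x <= s + eps ->
    exists2 x', mdist (root X) x' < s - eps & mdist x x' <= delta.
  move=> xs; have [|j jN Fx] := hF x; first by rewrite /cball /=; lra.
  have mx : inf (cell j) <= mdist (root X) x.
    by apply: ge_inf; [exact: (cell_inf j).2|exists x].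
  have mlt : 0 < s - eps - inf (cell j).
    rewrite subr_gt0 ltNge; apply/negP => h; apply: (good j jN).
    by apply/andP; split; lra.
  have [_ [x' Fx' <-] x's] := inf_adherent mlt (cell_inf j).
  exists x'; first by move: x's; rewrite addrC subrK.
  have := metric_triangle x (F j) x'; rewrite (metric_sym x (F j)).
  by move: Fx'; rewrite /=; lra.
apply: ereal_inf_lbound; exists (2 * delta) => //; split; first by lra.
- move=> _ [[x _ <-]]; rewrite /cball /= -(risoemb_root f) isoemb_mdist => xs.
  have [|x' x's xx'] := shrink x; first lra.
  have [|y xy] := fg x'; first lra.
  exists (g y).
    split; first by exists y.
    rewrite /cball /= (risoemb_root f) -(risoemb_root g) isoemb_mdist.
    by have := root_mdist_le f g x' y; lra.
  have := metric_triangle (f x) (f x') (g y); rewrite isoemb_mdist; lra.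
- move=> _ [[y _ <-]]; rewrite /cball /= -(risoemb_root g) isoemb_mdist => ys.
  have [|x xy] := gf y; first lra.
  have [|x' x's xx'] := shrink x.
    by have := root_mdist_le g f y x; rewrite (metric_sym (g y)); lra.
  exists (f x').
    by split; [exists x'|rewrite /cball /= (risoemb_root g) -(risoemb_root f) isoemb_mdist; lra].
  have := metric_triangle (g y) (f x) (f x'); rewrite isoemb_mdist.
  by rewrite (metric_sym (g y) (f x)); lra.
Qed.


Lemma expRN_le (t : R) : 0 < t -> expR (- t) <= t^-1.
Proof.
move=> t0; rewrite expRN lef_pV2 ?posrE ?expR_gt0//.
by have := expR_ge1Dx t; lra.
Qed.

Let indic_sum (m : nat -> R) (eps : R) N (s : R) : \bar R :=
  (\sum_(j < N) (\1_(`[m j - eps, m j + eps]%classic : set R) s)%:E)%E.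

Let indic_sum_ge0 m eps N s : (0 <= indic_sum m eps N s)%E.
Proof. by apply: sume_ge0 => j _; rewrite lee_fin. Qed.

(** This function dominates the integrand of [fell_dist]. For [s >= 0] its first term is
    [c * expR (- (s / 2))]: half of the exponent ensures integrability, the other half makes the
    tail small. Each bad radius costs an interval of length [2 * eps]. *)
Lemma integral_pdf_indic_sum (c eps : R) (m : nat -> R) N : 0 <= c -> 0 <= eps ->
  (\int[lebesgue_measure]_s ((2 * c)%:E * (exponential_pdf (2^-1 : R) s)%:E +
     indic_sum m eps N s) =
   (2 * c + 2 * eps * N%:R)%:E)%E.
Proof.
move=> c0 eps0; have pdf0 s : 0 <= exponential_pdf (2^-1 : R) s by apply: exponential_pdf_ge0.
have mpdf : measurable_fun setT (fun s : R => (exponential_pdf (2^-1 : R) s)%:E).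
  by apply/measurable_EFinP; exact: measurable_exponential_pdf.
have mI j : measurable_fun setT (fun s : R => (\1_(`[m j - eps, m j + eps]%classic : set R) s)%:E).
  by apply/measurable_EFinP; exact: measurable_indic.
rewrite /indic_sum ge0_integralD//; first last.
- by apply: emeasurable_sum => j; exact: mI.
- by move=> s _; apply: sume_ge0 => j _; rewrite lee_fin.
- exact: measurable_funeM.
- by move=> s _; rewrite -EFinM lee_fin !mulr_ge0.
rewrite EFinD; congr (_ + _)%E.
  rewrite ge0_integralZl//; last by rewrite lee_fin mulr_ge0.
  - by rewrite integral_exponential_pdf// mule1.
  - by move=> s _; rewrite lee_fin pdf0.
rewrite ge0_integral_sum//.
have lI j : lebesgue_measure (`[m j - eps, m j + eps]%classic : set R) = (2 * eps)%:E.
  rewrite lebesgue_measure_itv /= lte_fin.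
  case: ltP => [_|h]; first by rewrite -EFinB; congr EFin; lra.
  by congr EFin; lra.
rewrite (eq_bigr (fun=> (2 * eps)%:E)) => [|j _]; last first.
  by rewrite integral_indic// setIT; exact: lI.
  by rewrite sumEFin sumr_const card_ord mulr_natr.
by move=> j; apply/measurable_EFinP; exact: measurable_indic.
Qed.

(** Radii fall into three classes: beyond [s0] the weight is small, bad radii have total length at
    most [2 * eps * N], and at the others the Hausdorff distance is at most [2 * delta]. The net
    behind [N] depends on [X] alone, so [eps] is uniform in [Y] and [Z]. *)
Theorem fell_dist_small (X : rbcm R) e : 0 < e -> exists2 eps, 0 < eps &
  forall (Y Z : rbcm R) (f : risoemb X Z) (g : risoemb Y Z),
    fclose (range f) (range g) eps -> (fell_dist (range f) (range g) < e%:E)%E.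
Proof.
(* Both [2 * delta] and the tail factor [expR (- (s0 / 2)) <= 2 / s0] are at most [e / 8], so
   [2 * c <= e / 2]; the bad radii add at most [e / 4]. *)
move=> e0; pose delta := e / 16; pose s0 := 16 / e.
have d0 : 0 < delta by rewrite divr_gt0.
have s00 : 0 < s0 by rewrite divr_gt0.
have [N [m good]] := hausdorff_good_radius X s0 d0.
pose eps := Num.min delta (Num.min 1 (Num.min s0^-1 (e / 8 / N.+1%:R))).
have eps0 : 0 < eps by rewrite !lt_min d0 ltr01 invr_gt0 s00 !divr_gt0.
exists eps => // Y Z f g fg.
have eps_d : eps <= delta by rewrite ge_min lexx.
have eps1 : eps <= 1 by rewrite !ge_min lexx orbT.
have s0e : s0 <= eps^-1.
  by rewrite -[leLHS]invrK lef_pV2 ?posrE ?invr_gt0// !ge_min lexx !orbT.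
have epsN : 2 * eps * N%:R <= e / 4.
  have : eps <= e / 8 / N.+1%:R by rewrite !ge_min lexx !orbT.
  rewrite ler_pdivlMr// => epsN; have : eps * N%:R <= eps * N.+1%:R.
    by rewrite ler_pM2l// ler_nat.
  by rewrite -mulrA; lra.
pose c := 2 * delta + expR (- (s0 / 2)).
have c0 : 0 <= c by rewrite addr_ge0 ?expR_ge0 ?mulr_ge0// ltW.
have ce : 2 * c <= e / 2.
  have : expR (- (s0 / 2)) <= (s0 / 2)^-1 by apply: expRN_le; rewrite divr_gt0.
  have -> : (s0 / 2)^-1 = e / 8 by rewrite /s0; field; rewrite gt_eqF.
  by rewrite /c /delta; lra.
suff key (s : R) : 0 <= s -> (integrand (range f) (range g) s <=
    (2 * c)%:E * (exponential_pdf (2^-1 : R) s)%:E + indic_sum m eps N s)%E.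
  apply: (@le_lt_trans _ _ (2 * c + 2 * eps * N%:R)%:E); last by rewrite lte_fin; lra.
  rewrite -(integral_pdf_indic_sum m N c0 (ltW eps0)).
  rewrite /fell_dist integral_mkcond; apply: ge0_le_integral_nomeas => s _.
    by apply: erestrict_ge0 => r _; exact: integrand_ge0.
  rewrite patchE; case: ifPn => [|_].
    by rewrite inE /= in_itv /= andbT => /key.
  apply: adde_ge0; last exact: indic_sum_ge0.
  by rewrite -EFinM lee_fin mulr_ge0 ?mulr_ge0//; exact: exponential_pdf_ge0.
move=> s_ge0.
have pdfE : (2 * c) * exponential_pdf (2^-1 : R) s = c * expR (- (s / 2)).
  rewrite /exponential_pdf patchE ifT; last by rewrite inE /= in_itv /= andbT.
  by rewrite mulNr (mulrC 2^-1 s); lra.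
rewrite -EFinM pdfE.
have exp_half : expR (- s) = expR (- (s / 2)) * expR (- (s / 2)).
  by rewrite -expRD; congr expR; lra.
have exp_half1 : expR (- (s / 2)) <= 1 by rewrite -[leRHS]expR0 ler_expR; lra.
have [s0s|ss0] := ltP s0 s.
  apply: (@le_trans _ _ (c * expR (- (s / 2)))%:E); last by rewrite leeDl// indic_sum_ge0.
  apply: (@le_trans _ _ ((expR (- s))%:E * 1)%E).
    by apply: lee_pmul => //; rewrite ?lee_fin ?expR_ge0 ?le_min ?hausdorff_dist_ge0 ?andbT ?ge_min ?lexx.
  rewrite mule1 lee_fin exp_half; apply: ler_pM; rewrite ?expR_ge0//.
  have : expR (- (s / 2)) <= expR (- (s0 / 2)) by rewrite ler_expR; lra.
  by rewrite /c; lra.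
have [[j jN js]|nobad] := pselect (exists2 j, (j < N)%N & m j - eps <= s <= m j + eps).
  apply: (@le_trans _ _ (indic_sum m eps N s)); last first.
    by apply: leeDr; rewrite lee_fin mulr_ge0 ?expR_ge0.
  apply: (@le_trans _ _ 1%E).
    rewrite -[leRHS]mule1; apply: lee_pmul;
      rewrite ?lee_fin ?expR_ge0 ?le_min ?hausdorff_dist_ge0 ?andbT ?ge_min ?lexx//.
    by rewrite -[leRHS]expR0 ler_expR; lra.
  rewrite /indic_sum (bigD1 (Ordinal jN))//= indicE mem_set/= ?in_itv//.
  by apply: leeDl; apply: sume_ge0 => i _; rewrite lee_fin.
apply: (@le_trans _ _ (c * expR (- (s / 2)))%:E); last by rewrite leeDl// indic_sum_ge0.
apply: (@le_trans _ _ ((expR (- s))%:E * (2 * delta)%:E)%E).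
  apply: lee_pmul; rewrite ?lee_fin ?expR_ge0 ?le_min ?hausdorff_dist_ge0 ?andbT//.
  rewrite ge_min; apply/orP; right; apply: (good eps) => // j jN js.
  by apply: nobad; exists j.
rewrite -EFinM lee_fin mulrC; apply: ler_pM; rewrite ?expR_ge0 ?mulr_ge0//; first exact: ltW.
  by rewrite /c lerDl expR_ge0.
by rewrite ler_expR; lra.
Qed.

End fell_dist_facts.

(** * G_delta subsets and the conclusion *)

Lemma min_le_add (R : realType) (p a b c : R) : 0 <= p -> 0 <= b -> 0 <= c ->
  a <= b + c -> Num.min p a <= Num.min p b + Num.min p c.
Proof.
move=> p0 b0 c0 abc; rewrite ge_min.
case: (leP p b) => hb; case: (leP p c) => hc; apply/orP; [left|left|left|right];
  lra.
Qed.

Section alexandrov.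
Context {R : realType} {T G : Type}.
Variables (D : T -> T -> R) (U : nat -> set T) (i : G -> T).
Hypotheses (Dp : pseudo_on setT D) (Dc : complete_dist D).
Hypothesis Uo : forall k t, U k t -> exists2 e, 0 < e & forall t', D t t' < e -> U k t'.
Hypothesis iU : forall k g, U k (i g).
Hypothesis Ui : forall t, (forall k, U k t) -> exists g, D (i g) t = 0.

Let D0 t : D t t = 0. Proof. by case: Dp => h _ _; exact: h. Qed.
Let Ds s t : D s t = D t s. Proof. by case: Dp => _ h _; exact: h. Qed.
Let Dt t s u : D s u <= D s t + D t u. Proof. by case: Dp => _ _ h; exact: h. Qed.
Let Dge0 s t : 0 <= D s t. Proof. exact: pseudo_on_ge0 Dp _ _. Qed.

(* The constant 1 makes the infimum meaningful when U k is everything. *)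
Let depth_set k t := [set 1] `|` [set D t z | z in ~` U k].
Let depth k t : R := inf (depth_set k t).

Let depth_has_inf k t : has_inf (depth_set k t).
Proof.
split; first by exists 1; left.
by exists 0 => _ [->//|[z _ <-]].
Qed.

Let depth_le k t m : depth_set k t m -> depth k t <= m.
Proof. by apply: ge_inf; case: (depth_has_inf k t). Qed.

Let depth_ge k t m : m <= 1 -> (forall z, ~ U k z -> m <= D t z) -> m <= depth k t.
Proof.
move=> m1 h; apply: lb_le_inf; first by case: (depth_has_inf k t).
by move=> _ [->//|[z nUz <-]]; exact: h.
Qed.

Let depth_lip k s t : depth k s <= depth k t + D s t.
Proof.
rewrite -lerBlDr; apply: depth_ge => [|z nUz].
  by have := Dge0 s t; have := depth_le (k := k) (t := s) (or_introl erefl); lra.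
have : depth k s <= D s z by apply: depth_le; right; exists z.
by have := Dt t s z; lra.
Qed.

Let depth_gt0 k t : U k t -> 0 < depth k t.
Proof.
move=> /Uo[e e0 he]; apply: (@lt_le_trans _ _ (Num.min e 1)); first by rewrite lt_min e0 ltr01.
apply: depth_ge => [|z nUz]; first by rewrite ge_min lexx orbT.
by rewrite ge_min; apply/orP; left; rewrite leNgt; apply/negP => /he.
Qed.

Let depth_U k t : 0 < depth k t -> U k t.
Proof.
move=> d0; apply: contrapT => nU.
suff : depth k t <= 0 by rewrite leNgt d0.
by apply: depth_le; right; exists t.
Qed.

(** The inverse depth blows up at the boundary of [U k], so a Cauchy sequence cannot escape from it;
    the cap [2 ^- k] keeps the supremum over [k] finite and its tail small. *)
Let gap k (g g' : G) : R :=
  Num.min (2 ^- k) `|(depth k (i g))^-1 - (depth k (i g'))^-1|.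
Let sgap (g g' : G) : R := sup [set gap k g g' | k in setT].

Definition alex_dist (g g' : G) : R := D (i g) (i g') + sgap g g'.

Let gap_ge0 k g g' : 0 <= gap k g g'.
Proof. by rewrite le_min normr_ge0 ltW// exp2N_gt0. Qed.

Let gap_le k g g' : gap k g g' <= sgap g g'.
Proof.
apply: ub_le_sup; last by exists k.
by exists 1 => _ [j _ <-]; rewrite ge_min exp2N_le1.
Qed.

Let sgap_le g g' m : (forall k, gap k g g' <= m) -> sgap g g' <= m.
Proof. by move=> h; apply: ge_sup => [|_ [k _ <-]//]; exists (gap 0 g g'), 0%N. Qed.

Let sgap_ge0 g g' : 0 <= sgap g g'.
Proof. exact: le_trans (gap_ge0 0 g g') (gap_le 0 g g'). Qed.

Lemma alex_dist_ge g g' : D (i g) (i g') <= alex_dist g g'.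
Proof. by rewrite lerDl. Qed.

Lemma alex_dist_pseudo : pseudo_on setT alex_dist.
Proof.
split=> [g _|g g' _ _|g' g g'' _ _ _].
- rewrite /alex_dist D0 add0r; apply/eqP; rewrite eq_le sgap_ge0 andbT.
  by apply: sgap_le => k; rewrite /gap subrr normr0 ge_min lexx orbT.
- rewrite /alex_dist Ds; congr (_ + sup _); apply/seteqP.
  by split=> _ [k _ <-]; exists k => //; rewrite /gap distrC.
- rewrite /alex_dist addrACA; apply: lerD; first exact: Dt.
  apply: sgap_le => k; apply: le_trans (lerD (gap_le k _ _) (gap_le k _ _)).
  apply: (min_le_add (ltW (exp2N_gt0 k)) (normr_ge0 _) (normr_ge0 _)).
  exact: ler_distD.
Qed.

Let inv_depth_cont k g e : 0 < e -> exists2 e', 0 < e' & forall g',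
  D (i g) (i g') < e' -> `|(depth k (i g))^-1 - (depth k (i g'))^-1| <= e.
Proof.
move=> e0; have a0 := depth_gt0 (iU k g); set a := depth k (i g) in a0 *.
exists (Num.min (a / 2) (a * a * e / 2)) => [|g'].
  by rewrite lt_min !divr_gt0// !mulr_gt0.
rewrite lt_min => /andP[h1 h2]; set b := depth k (i g').
have ab : a <= b + D (i g) (i g') by exact: depth_lip.
have ba : b <= a + D (i g) (i g') by rewrite Ds; exact: depth_lip.
have b0 : a / 2 < b by lra.
have b00 : 0 < b by apply: lt_trans b0; rewrite divr_gt0.
have -> : a^-1 - b^-1 = (b - a) / (a * b) by field; rewrite !gt_eqF.
rewrite normrM normfV (gtr0_norm (mulr_gt0 a0 b00)) ler_pdivrMr ?mulr_gt0//.
have : `|b - a| <= D (i g) (i g') by rewrite ler_norml; lra.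
move=> /le_trans; apply; apply: ltW; apply: lt_le_trans h2 _.
have -> : a * a * e / 2 = (e * a) * (a / 2) by field.
by rewrite (mulrA e) ler_pM2l ?mulr_gt0// ltW.
Qed.

Lemma alex_dist_top g e : 0 < e -> exists2 e', 0 < e' & forall g',
  D (i g) (i g') < e' -> alex_dist g g' < e.
Proof.
move=> e0; have e30 : 0 < e / 3 by rewrite divr_gt0.
have [K hK] := exp2N_small e30.
have [e' e'0 he'] : exists2 e', 0 < e' & forall g', D (i g) (i g') < e' ->
    forall k, (k < K)%N -> gap k g g' <= e / 3.
  elim: {hK} K => [|K [e1 e10 he1]]; first by exists 1.
  have [e2 e20 he2] := inv_depth_cont K g e30.
  exists (Num.min e1 e2) => [|g']; first by rewrite lt_min e10.
  rewrite lt_min => /andP[/he1 h1 /he2 h2] k; rewrite ltnS leq_eqVlt => /predU1P[->|/h1//].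
  by rewrite ge_min h2 orbT.
exists (Num.min e' (e / 3)) => [|g']; first by rewrite lt_min e'0.
rewrite lt_min => /andP[/he' h1 h2].
have : sgap g g' <= e / 3.
  apply: sgap_le => k; have [/h1//|Kk] := ltnP k K.
  by rewrite ge_min hK.
by rewrite /alex_dist; lra.
Qed.

Lemma alex_dist_complete : complete_dist alex_dist.
Proof.
move=> u uc.
have [|l ul] := Dc (u := i \o u).
  move=> e /uc[N hN]; exists N => m n Nm Nn.
  exact: le_lt_trans (alex_dist_ge _ _) (hN m n Nm Nn).
have {}ul e : 0 < e -> exists N, forall n, (N <= n)%N -> D (i (u n)) l < e.
  move=> e0; have /cvgrPdist_lt/(_ _ e0)[N _ hN] := ul; exists N => n /hN.
  by rewrite sub0r normrN ger0_norm.
have Ul k : U k l.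
  (* Below distance [2 ^- k] the cap on the gap is inactive, so from index [N] on the inverse depth
     differs by less than 1 from its value at [N]. The depth thus stays above [M^-1] and is positive
     at the limit. *)
  have [N hN] := uc _ (exp2N_gt0 k).
  pose M := (depth k (i (u N)))^-1 + 1.
  have M0 : 0 < M by rewrite addr_gt0// invr_gt0 depth_gt0.
  have bound m : (N <= m)%N -> M^-1 <= depth k (i (u m)).
    move=> Nm; have dm := depth_gt0 (iU k (u m)).
    rewrite -[leRHS]invrK lef_pV2 ?posrE ?invr_gt0//.
    have : gap k (u N) (u m) < 2 ^- k.
      apply: le_lt_trans (gap_le _ _ _) _; apply: le_lt_trans (hN N m (leqnn N) Nm).
      by rewrite lerDr.
    rewrite /gap gt_min ltxx /= => h.
    have := ler_norm ((depth k (i (u m)))^-1 - (depth k (i (u N)))^-1).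
    by rewrite distrC; have := exp2N_le1 (R := R) k; rewrite /M; move: h; lra.
  apply: depth_U; have M10 : 0 < M^-1 by rewrite invr_gt0.
  have [N' hN'] := ul _ M10.
  have := hN' (maxn N N') (leq_maxr _ _); have := bound (maxn N N') (leq_maxl _ _).
  by have := depth_lip k (i (u (maxn N N'))) l; rewrite /=; lra.
have [g gl] := Ui Ul; exists g; apply/cvgrPdist_lt => e e0.
have [_ ads _] := alex_dist_pseudo.
have [e' e'0 he'] := alex_dist_top g e0; have [N hN] := ul _ e'0.
exists N => // n /= Nn; rewrite sub0r normrN ger0_norm; last first.
  exact: pseudo_on_ge0 alex_dist_pseudo _ _.
rewrite ads//; apply: he'; apply: le_lt_trans (hN n Nn).
by apply: le_trans (Dt l _ _) _; rewrite gl add0r Ds.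
Qed.

End alexandrov.

(** Points of [C] need not come from [G]: for each [c] and [n], one point of [G] whose image is
    within [2 ^- n] of [c] is selected when there is one. *)
Lemma countable_dense_sub (R : realType) (T G : Type) (D : T -> T -> R) (i : G -> T) (C : set T) :
  pseudo_on setT D -> countable C ->
  (forall t e, 0 < e -> exists2 c, C c & D t c < e) ->
  exists2 E : set G, countable E &
    forall g e, 0 < e -> exists2 g', E g' & D (i g) (i g') < e.
Proof.
move=> [_ Ds Dt] cC hC.
have /dependent_choice_ex[sel hsel] : forall cn : T * nat, exists o : option G,
    (forall g, D cn.1 (i g) < 2 ^- cn.2 -> exists g', o = Some g') /\
    (forall g', o = Some g' -> D cn.1 (i g') < 2 ^- cn.2).
  move=> cn; have [[g gP]|ng] := pselect (exists g, D cn.1 (i g) < 2 ^- cn.2).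
    by exists (Some g); split=> [_ _|_ [<-]//]; exists g.
  by exists None; split=> // g hg; exfalso; apply: ng; exists g.
exists (\bigcup_(c in C) \bigcup_n [set g | sel (c, n) = Some g]).
  apply: bigcup_countable => // c _; apply: bigcup_countable => [|n _]; first exact: countableP.
  case: (sel (c, n)) => [g|].
    by apply: (sub_countable (B := [set g])) => //; apply: subset_card_le => g' /= [->].
  by apply: (sub_countable (B := set0)) => //; apply: subset_card_le => g' /=.
move=> g e e0; have e20 : 0 < e / 2 by rewrite divr_gt0.
have [n hn] := exp2N_small e20; have {}hn := hn n (leqnn n).
have [c Cc gc] := hC (i g) _ (exp2N_gt0 n).
have [h1 h2] := hsel (c, n).
have [|g' sg'] := h1 g; first by rewrite /= Ds.
exists g'; first by exists c => //; exists n.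
by have := h2 g' sg'; have := Dt c (i g) (i g') I I I; rewrite /=; lra.
Qed.

(** * Small integrated distance against small [mmdist] *)

Section marked_dist_topology.
Context {R : realType} {tau : structure R} (S : srm tau).

(** Here [e'] depends on [x], through the finite net that locates the bad radii; the converse
    [mmdist_small] is uniform. *)
Lemma marked_dist_small (x : marked tau) e : 0 < e -> exists2 e', 0 < e' &
  forall y, mmdist S x y < e' -> (marked_dist S x y < e%:E)%E.
Proof.
move=> e0; have [eps eps0 heps] := fell_dist_small (mk_space x) e0.
pose e' := Num.min (Num.min eps 1) (e / 2).
have e'0 : 0 < e' by rewrite !lt_min eps0 ltr01 divr_gt0.
exists e' => // y; have e'1 : e' <= 1 by rewrite !ge_min lexx orbT.
have e'eps : e' <= eps by rewrite !ge_min lexx.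
have e'e : e' < e by rewrite gt_min; apply/orP; right; lra.
move=> /(mmdist_linked e'1)[Z [f [g [fg ab]]]].
apply: (@le_lt_trans _ _ (maxe (fell_dist (range f) (range g))
    (srm_dist S Z (str_map f (mk_mark x)) (str_map g (mk_mark y)))%:E)).
  by apply: ereal_inf_lbound; exists Z, f, g.
rewrite gt_max heps; last exact: fclose_le fg.
by rewrite lte_fin (le_lt_trans ab).
Qed.

Lemma mmdist_small e : 0 < e -> exists2 e', 0 < e' &
  forall x y : marked tau, (marked_dist S x y < e'%:E)%E -> mmdist S x y < e.
Proof.
move=> e0; pose e1 := e / 2; have e10 : 0 < e1 by rewrite divr_gt0.
pose c := expR (- (e1^-1 + 1)) * Num.min 1 e1.
have c0 : 0 < c by rewrite mulr_gt0 ?expR_gt0// lt_min ltr01.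
exists (Num.min c e1) => [|x y]; first by rewrite lt_min c0.
move=> /ereal_inf_lt[_ [Z [f [g ->]]]]; rewrite gt_max => /andP[fg].
rewrite lte_fin lt_min => /andP[_ /ltW ab].
apply: (@le_lt_trans _ _ e1); last by rewrite /e1; lra.
apply: mmdist_le; split=> //; right; exists Z, f, g; split=> //.
apply: fell_dist_fclose => //; apply: lt_le_trans fg _.
by rewrite lee_fin ge_min lexx.
Qed.

End marked_dist_topology.

Lemma metrizes_pullback (R : realType) (T U : topologicalType) (f : T -> U)
    (d : U -> U -> R) :
  topological_embedding f -> metrizes d -> metrizes (fun x y => d (f x) (f y)).
Proof.
move=> [fi fc fo] dU; have [[d0 dpos ds dt] dtop] := dU; split.
  by split=> [x|x y /dpos/fi|x y|y x z].
move=> A; split=> [/fo[B oB fAB] x Ax|hA].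
  have Bfx : B (f x) by have [] : (B `&` range f) (f x) by rewrite -fAB; exists x.
  have [e e0 eB] := (dtop B).1 oB (f x) Bfx; exists e => // y /= /eB By.
  have [z Az /fi <-//] : (f @` A) (f y) by rewrite fAB; split => //; exists y.
rewrite openE => x /hA[e e0 eA]; apply: filterS eA _.
exact: fc (metrizes_ball (f x) dU e0).
Qed.

Section pullback_srm.
Context {R : realType} {tau tau' : structure R} (S' : srm tau').
Variable eta : forall X : bcm R, tau X -> tau' X.
Hypothesis eta_emb : str_topological_embedding eta.

Definition pullback_srm : srm tau.
Proof.
apply: (@Srm R tau (fun X a b => srm_dist S' X (@eta X a) (@eta X b))) => [X|X Y f a b].
  exact: metrizes_pullback (eta_emb.1 X) (srm_metrizes S' X).
by rewrite !eta_emb.2 srm_isometric.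
Defined.

Definition marked_map (x : marked tau) : marked tau' := Marked (@eta _ (mk_mark x)).

Lemma marked_map_iso x y : marked_iso (marked_map x) (marked_map y) <-> marked_iso x y.
Proof.
split=> -[f [fb fa]]; exists f; split=> //.
  by have [einj _ _] := eta_emb.1 (mk_space y); apply: einj; rewrite eta_emb.2.
by rewrite /= -eta_emb.2 fa.
Qed.

Lemma mmdist_pullback x y : mmdist pullback_srm x y = mmdist S' (marked_map x) (marked_map y).
Proof.
congr inf; apply/seteqP; split=> e [e0 [e1|[Z [f [g [fg ab]]]]]];
  split=> //; (try by left); right; exists Z, f, g; split=> //;
  by move: ab; rewrite /= !eta_emb.2.
Qed.

End pullback_srm.

Theorem theorem6p47 (R : realType) (tau tau' : structure R)
    (htau : polish_with_preserved_roots tau tau')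
    (hsep : forall X : bcm R, separable (tau' X)) :
  inhabited (srm tau) /\ forall S : srm tau, polish R (GHspace S).
Proof.
have [eta [sub [[eta_emb _] [[ec uc lc] [S' S'c]] sub_open etaE]]] := htau.
pose Se := pullback_srm S' eta_emb; split; first exact: (inhabits Se).
move=> S; pose D := mmdist S'.
have Dp : pseudo_on setT D := mmdist_pseudo S'.
pose i (p : GHspace S) : marked tau' := marked_map eta (repr (p : marked_class tau)).
pose U k (t : marked tau') := sub k (mk_space t) (mk_mark t).
have Uo k t : U k t -> exists2 e, 0 < e & forall t', D t t' < e -> U k t'.
  by apply: mmdist_open; [exact: (sub_open k).1|exact: (sub_open k).2].
have iU k p : U k (i p).
  have : range (eta (mk_space (i p))) (mk_mark (i p)) by exists (mk_mark (repr (p : marked_class tau))).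
  by rewrite etaE; apply.
(* By (P3) a triple in all [U k] carries a mark coming from [tau]; passing to the representative of
   its class changes it only by an isometry, that is by distance 0. *)
have Ui t : (forall k, U k t) -> exists p, D (i p) t = 0.
  case: t => X b Ub; have [a _ ab] : range (eta X) b by rewrite etaE => k _; exact: Ub.
  exists (\pi_(marked_class tau)%qT (Marked a) : GHspace S); apply: mmdist_iso.
  rewrite -ab; apply/(marked_map_iso eta_emb _ (Marked a))/asboolP.
  rewrite -/(marked_equiv _ _); by apply/(eqquotP (marked_class tau)); rewrite reprK.
have [_ ds dt] := alex_dist_pseudo U i Dp.
have d_ge := alex_dist_ge D U i; have d_top := alex_dist_top Dp Uo iU.
have d_complete := alex_dist_complete Dp (mmdist_complete S'c uc) Uo iU Ui.
set d := alex_dist D U i in ds dt d_ge d_top d_complete.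
(* The route between the two distances: [d] dominates [mmdist S'], which is [mmdist Se] on triples
   of [tau], and [mmdist_indep] exchanges [Se] for the given [S]. *)
have class_d p e : 0 < e -> exists2 e', 0 < e' & forall q, d p q < e' -> (class_dist S p q < e%:E)%E.
  move=> e0; have [e1 e10 h1] := marked_dist_small S (repr (p : marked_class tau)) e0.
  have [e2 e20 h2] := mmdist_indep Se S (repr (p : marked_class tau)) e10.
  exists e2 => // q pq; apply/h1/h2; rewrite mmdist_pullback.
  exact: le_lt_trans (d_ge p q) pq.
have d_class p e : 0 < e -> exists2 e', 0 < e' & forall q, (class_dist S p q < e'%:E)%E -> d p q < e.
  move=> e0; have [e1 e10 h1] := d_top p e e0.
  have [e2 e20 h2] := mmdist_indep S Se (repr (p : marked_class tau)) e10.
  have [e3 e30 h3] := mmdist_small S e20.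
  exists e3 => // q /h3/h2; rewrite mmdist_pullback; exact: h1.
have GHopenP (A : set (GHspace S)) : open A <->
    forall x, A x -> exists2 e, 0 < e & [set y | d x y < e] `<=` A.
  rewrite -[open A]/(@GHopen R tau S A).
  split=> [oA x /oA[e e0 eA]|hA x /hA[e e0 eA]].
    by have [e' e'0 he'] := class_d x e e0; exists e' => // y /he' /eA.
  by have [e' e'0 he'] := d_class x e e0; exists e' => // y /he' /eA.
split.
  have [C cC hC] := mmdist_separable S' lc hsep.
  have [E cE hE] := countable_dense_sub i Dp cC hC.
  exists E => // A [p Ap] /GHopenP oA; have [e e0 eA] := oA p Ap.
  have [e' e'0 he'] := d_top p e e0; have [q Eq pq] := hE p e' e'0.
  by exists q; split=> //; apply: eA; exact: he'.
exists d; split => //; split; last exact: GHopenP.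
have [d0 _ _] := alex_dist_pseudo U i Dp.
split=> [x|x y xy0|x y|y x z]; [exact: d0| |exact: ds|exact: dt].
(* Separation of classes: distance 0 gives an isomorphism of triples of [tau'], which descends to
   [tau] because [eta] is natural and injective. *)
have : D (i x) (i y) = 0.
  apply/eqP; rewrite eq_le (pseudo_on_ge0 Dp)// andbT -xy0; exact: d_ge.
move=> /(mmdist_eq0_iso ec)/(marked_map_iso eta_emb) xy.
rewrite -[x](reprK (x : marked_class tau)) -[y](reprK (y : marked_class tau)).
by apply/(eqquotP (marked_class tau))/asboolP.
Qed.
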